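(* Let $V$ be a smooth, connected variety over $\mathbb{Z}$ of positive dimension, and let $q$ be any odd prime power. Let $\mu$ be the Möbius function, and define $M_k(V,q):=\frac1k\sum_{m\mid k}\mu\left(\frac km\right)|V(\mathbb{F}_{q^m})|$ for each $k\ge1$. For any finite sequence of nonnegative integers $\lambda=(\lambda_1,\dots,\lambda_l)$, the following equality of formal power series in $t$ holds: $$\sum_{n=0}^\infty\left[\sum_{C\in\mathrm{Conf}_nV(\mathbb{F}_q)}\binom{X}{\lambda}(\sigma_C)\right]t^n=\frac{Z(V,t)}{Z(V,t^2)}\cdot\prod_{k=1}^l\binom{M_k(V,q)}{\lambda_k}\left(\frac{t^k}{1+t^k}\right)^{\lambda_k}.$$
   Context: **Configuration spaces.** $\mathrm{Conf}_nV$ is the scheme-theoretic quotient $\{(x_1,\dots,x_n)\in V^n: x_i\neq x_j\ \forall i\neq j\}/S_n$, where $S_n$ permutes the coordinates. An element of $\mathrm{Conf}_nV(\mathbb{F}_q)$ is a set $C=\{x_1,\dots,x_n\}\subseteq V(\overline{\mathbb{F}}_q)$ of $n$ distinct points that is preserved by the Frobenius map $\mathrm{Frob}_q:V(\overline{\mathbb{F}}_q)\to V(\overline{\mathbb{F}}_q)$. The action of $\mathrm{Frob}_q$ on $C$ gives a permutation $\sigma_C\in S_n$, well defined up to conjugacy, so any class function $\chi$ of $S_n$ has a well-defined value $\chi(\sigma_C)$. For $n=0$ the only element is the empty set. **Class functions.** For $\sigma\in S_n$, $X_k(\sigma)$ is the number of $k$-cycles in the cycle decomposition of $\sigma$, and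 $\binom{X}{\lambda}:=\binom{X_1}{\lambda_1}\binom{X_2}{\lambda_2}\cdots\binom{X_l}{\lambda_l}$. **Zeta function.** $Z(V,t):=\prod_x(1-t^{\deg x})^{-1}$, the product over all closed points $x$ of $V$ over $\mathbb{F}_q$ (i.e. of $V_{\mathbb{F}_q}$); equivalently $Z(V,t)=\prod_{k\ge1}(1-t^k)^{-M_k(V,q)}$, where $M_k(V,q)$ is the number of closed points of degree $k$. *)

(* Defs.v *)
From HB Require Import structures.
From mathcomp Require Import all_boot all_order all_algebra all_fingroup.
From mathcomp Require Import boolp classical_sets functions cardinality fsbigop.

Set Implicit Arguments.
Unset Strict Implicit.
Unset Printing Implicit Defensive.
Import GRing.Theory.
Local Open Scope classical_set_scope.
Local Open Scope card_scope.
Local Open Scope ring_scope.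

Record fps (R : Type) := Fps { fcoef : nat -> R }.

Lemma fpsP (R : Type) (f g : fps R) : fcoef f =1 fcoef g -> f = g.
Proof. by case: f g => [f] [g] /= /funext ->. Qed.

HB.instance Definition _ (R : Type) := gen_eqMixin (fps R).
HB.instance Definition _ (R : Type) := gen_choiceMixin (fps R).

Section FpsRing.
Variable R : comUnitRingType.
Implicit Types f g h : fps R.

Let add f g := Fps (fun n => fcoef f n + fcoef g n).
Let opp f := Fps (fun n => - fcoef f n).
Let zero : fps R := Fps (fun=> 0).

Fact fps_addA : associative add.
Proof. by move=> f g h; apply: fpsP => n /=; rewrite addrA. Qed.
Fact fps_addC : commutative add.
Proof. by move=> f g; apply: fpsP => n /=; rewrite addrC. Qed.
Fact fps_add0 : left_id zero add.
Proof. by move=> f; apply: fpsP => n /=; rewrite add0r. Qed.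
Fact fps_addN : left_inverse zero opp add.
Proof. by move=> f; apply: fpsP => n /=; rewrite addNr. Qed.

HB.instance Definition _ :=
  GRing.isZmodule.Build (fps R) fps_addA fps_addC fps_add0 fps_addN.

Definition fps_one : fps R := Fps (fun n => (n == 0%N)%:R).
Definition fps_mul f g : fps R :=
  Fps (fun n => \sum_(i < n.+1) fcoef f i * fcoef g (n - i)).

Let trunc n f : {poly R} := \poly_(i < n.+1) fcoef f i.

Fact fcoef_mul_trunc n m f g : (n <= m)%N ->
  fcoef (fps_mul f g) n = (trunc m f * trunc m g)`_n.
Proof.
move=> le_nm; rewrite coefM; apply: eq_bigr => i _.
have le_in : (i <= n)%N by rewrite -ltnS.
rewrite !coef_poly !ltnS (leq_trans le_in le_nm).
by rewrite (leq_trans (leq_subr _ _) le_nm).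
Qed.

Fact fps_mulC : commutative fps_mul.
Proof.
by move=> f g; apply: fpsP => n; rewrite !(fcoef_mul_trunc _ _ (leqnn n)) mulrC.
Qed.

Fact fps_mulA : associative fps_mul.
Proof.
move=> f g h; apply: fpsP => n.
pose agrees (f1 : fps R) (p : {poly R}) := forall i, (i <= n)%N -> fcoef f1 i = p`_i.
have agrM p q f1 f2 : agrees f1 p -> agrees f2 q ->
    fcoef (fps_mul f1 f2) n = (p * q)`_n.
  move=> ep eq; rewrite coefM; apply: eq_bigr => i _.
  by rewrite ep ?eq ?leq_subr // -ltnS.
have agr f1 : agrees f1 (trunc n f1) by move=> i le_in; rewrite coef_poly ltnS le_in.
have agr2 f1 f2 : agrees (fps_mul f1 f2) (trunc n f1 * trunc n f2).
  by move=> i le_in; exact: fcoef_mul_trunc.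
by rewrite (agrM _ _ _ _ (agr f) (agr2 g h)) (agrM _ _ _ _ (agr2 f g) (agr h)) mulrA.
Qed.

Fact fps_mul1 : left_id fps_one fps_mul.
Proof.
move=> f; apply: fpsP => n /=.
rewrite big_ord_recl subn0 /= mul1r big1 ?addr0 // => i _.
by rewrite mul0r.
Qed.

Fact fps_mulDl : left_distributive fps_mul +%R.
Proof.
move=> f g h; apply: fpsP => n /=.
by rewrite -big_split; apply: eq_bigr => i _; rewrite mulrDl.
Qed.

Fact fps_one_neq0 : fps_one != 0.
Proof.
by apply/eqP => /(congr1 (fun f => fcoef f 0)) /eqP; rewrite /= oner_eq0.
Qed.

HB.instance Definition _ := GRing.Zmodule_isComNzRing.Build (fps R)
  fps_mulA fps_mulC fps_mul1 fps_mulDl fps_one_neq0.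

Definition fps_unit : pred (fps R) := fun f => fcoef f 0 \is a GRing.unit.

Fixpoint fps_inv_seq f (n : nat) : seq R :=
  if n is n'.+1 then
    let s := fps_inv_seq f n' in
    rcons s (- (fcoef f 0)^-1 * \sum_(i < n) fcoef f i.+1 * s`_(n' - i))
  else [:: (fcoef f 0)^-1].

Definition fps_inv f : fps R :=
  if f \in fps_unit then Fps (fun n => (fps_inv_seq f n)`_n) else f.

Fact size_fps_inv_seq f n : size (fps_inv_seq f n) = n.+1.
Proof. by elim: n => //= n IHn; rewrite size_rcons IHn. Qed.

Fact nth_fps_inv_seq f n i : (i <= n)%N ->
  (fps_inv_seq f n)`_i = (fps_inv_seq f i)`_i.
Proof.
elim: n => [|n IHn]; first by rewrite leqn0 => /eqP ->.
rewrite leq_eqVlt => /predU1P[-> //|le_in].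
by rewrite /= nth_rcons size_fps_inv_seq le_in IHn.
Qed.

Fact fps_mulV : {in fps_unit, left_inverse 1 fps_inv *%R}.
Proof.
move=> f Uf; rewrite mulrC; apply: fpsP => n.
rewrite /fps_inv Uf /GRing.mul /= big_ord_recl subn0.
case: n => [|n] /=; first by rewrite big_ord0 addr0 divrr.
rewrite nth_rcons size_fps_inv_seq ltnn eqxx mulNr mulrN mulrA divrr // mul1r.
rewrite addrC; apply/eqP; rewrite subr_eq0; apply/eqP; apply: eq_bigr => i _.
by rewrite /bump /= subSS [in RHS]nth_fps_inv_seq ?leq_subr.
Qed.

Fact fps_unitP f g : g * f = 1 -> fps_unit f.
Proof.
move=> /(congr1 (fun f => fcoef f 0)) /=; rewrite big_ord_recl big_ord0 addr0.
by move=> gf1; apply/unitrPr; exists (fcoef g 0); rewrite mulrC.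
Qed.

Fact fps_inv_out : {in [predC fps_unit], fps_inv =1 id}.
Proof. by move=> f; rewrite inE /= /fps_inv => /negbTE ->. Qed.

HB.instance Definition _ := GRing.ComNzRing_hasMulInverse.Build (fps R)
  fps_mulV fps_unitP fps_inv_out.

Definition fpsC (a : R) : fps R := Fps (fun n => if n == 0%N then a else 0).
Definition fpsX : fps R := Fps (fun n => (n == 1%N)%:R).

(* The series f(t ^ d), for d > 0. *)
Definition fps_dilate (d : nat) f : fps R :=
  Fps (fun n => if (d %| n)%N then fcoef f (n %/ d) else 0).

End FpsRing.

Arguments fpsX {R}.
Notation "''t'" := fpsX : ring_scope.

(* Schemes over the integers are given by their functors of points, functors from
   commutative rings to sets.  By Yoneda, an element u of X A is the same thing as
   a morphism Spec A -> X; the predicates is_mono, open_immersion, ... below are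
   about this morphism. *)

Record zfunctor := ZFunctor {
  pts :> comPzRingType -> Type;
  fmap : forall A B : comPzRingType, {rmorphism A -> B} -> pts A -> pts B;
  fmap_id : forall (A : comPzRingType) (x : pts A), fmap idfun x = x;
  fmap_comp : forall (A B C : comPzRingType) (f : {rmorphism A -> B})
    (g : {rmorphism B -> C}) (x : pts A), fmap (g \o f) x = fmap g (fmap f x)
}.
Arguments fmap X {A B} f x : rename.

Lemma rmorphism_ext (A B : comPzRingType) (f g : {rmorphism A -> B}) :
  f =1 g -> f = g.
Proof.
case: f g => [f cf] [g cg] /= /funext eq_fg; case: _ / eq_fg in cg *.
case: cg cf => [[a] [b]] [[c] [d]].
by rewrite (Prop_irrelevance a c) (Prop_irrelevance b d).
Qed.

Section Spec.
Variable k : comPzRingType.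

Let Spec_map (A B : comPzRingType) (f : {rmorphism A -> B}) (x : {rmorphism k -> A}) :
  {rmorphism k -> B} := f \o x.

Fact Spec_map_id (A : comPzRingType) (x : {rmorphism k -> A}) : Spec_map idfun x = x.
Proof. exact: (@rmorphism_ext k A). Qed.

Fact Spec_map_comp (A B C : comPzRingType) (f : {rmorphism A -> B})
  (g : {rmorphism B -> C}) (x : {rmorphism k -> A}) :
  Spec_map (g \o f) x = Spec_map g (Spec_map f x).
Proof. exact: (@rmorphism_ext k C). Qed.

Definition Spec : zfunctor := ZFunctor Spec_map_id Spec_map_comp.

End Spec.

Section Product.
Variables X Y : zfunctor.

Let fun_prod_map (A B : comPzRingType) (f : {rmorphism A -> B}) (x : X A * Y A) :
  X B * Y B := (fmap X f x.1, fmap Y f x.2).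

Fact fun_prod_map_id (A : comPzRingType) (x : X A * Y A) : fun_prod_map idfun x = x.
Proof. by case: x => x y; rewrite /fun_prod_map !fmap_id. Qed.

Fact fun_prod_map_comp (A B C : comPzRingType) (f : {rmorphism A -> B})
  (g : {rmorphism B -> C}) (x : X A * Y A) :
  fun_prod_map (g \o f) x = fun_prod_map g (fun_prod_map f x).
Proof. by rewrite /fun_prod_map !fmap_comp. Qed.

Definition fun_prod : zfunctor := ZFunctor fun_prod_map_id fun_prod_map_comp.

End Product.

(* The fibre product with Spec k over Spec int; (pt x).2 below is then the
   structure map from k to the residue field. *)
Definition base_change (X : zfunctor) (k : comPzRingType) := fun_prod X (Spec k).

Section Topology.
Variable X : zfunctor.

Definition subfunctor := forall B : comPzRingType, set (X B).

Definition generate_unit (A B : comPzRingType) (f : {rmorphism A -> B})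
    (I : set A) : Prop :=
  exists n (b : 'I_n -> B) (s : 'I_n -> A),
    (forall i, I (s i)) /\ \sum_i b i * f (s i) = 1.

(* The pullback of U along any Spec A -> X is the complement D(I) of V(I) for
   some I; such U correspond to the open subsets of the space underlying X. *)
Definition open_sub (U : subfunctor) : Prop :=
  forall (A : comPzRingType) (a : X A), exists I : set A,
    forall (B : comPzRingType) (f : {rmorphism A -> B}),
      U B (fmap X f a) <-> generate_unit f I.

Definition image_sub (A : comPzRingType) (u : X A) : subfunctor :=
  fun B => [set y | exists f : {rmorphism A -> B}, fmap X f u = y].

Definition is_mono (A : comPzRingType) (u : X A) : Prop :=
  forall (B : comPzRingType) (f g : {rmorphism A -> B}),
    fmap X f u = fmap X g u -> f =1 g.

Definition open_immersion (A : comPzRingType) (u : X A) : Prop :=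
  is_mono u /\ open_sub (image_sub u).

(* A point of the underlying space, represented by Spec kappa -> X with kappa
   its residue field: a morphism from the spectrum of a field to a scheme is a
   monomorphism exactly when it is, up to isomorphism, the canonical morphism
   of the residue field at its image point. *)
Record scheme_point := SchemePoint {
  residue : fieldType;
  pt : X residue;
  pt_mono : is_mono pt
}.

Definition same_point (x y : scheme_point) : Prop :=
  exists f : {rmorphism residue x -> residue y},
    bijective f /\ fmap X f (pt x) = pt y.

(* The complement of x is open; an L-valued point lies over x if and only if it
   factors through the residue field of x. *)
Definition closed_point (x : scheme_point) : Prop :=
  exists2 U : subfunctor, open_sub U &
    forall (L : fieldType) (y : X L), U L y <-> ~ image_sub (pt x) y.

End Topology.

Definition unit_elt (A : comPzRingType) (a : A) : Prop := exists b, a * b = 1.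

(* B is the localization of A at the powers of a, with structure map l. *)
Definition is_localization (A B : comPzRingType) (a : A)
    (l : {rmorphism A -> B}) : Prop :=
  [/\ unit_elt (l a),
      forall (C : comPzRingType) (f : {rmorphism A -> C}), unit_elt (f a) ->
        exists g : {rmorphism B -> C}, g \o l =1 f
    & forall (C : comPzRingType) (g h : {rmorphism B -> C}),
        g \o l =1 h \o l -> g =1 h].

(* The overlap of Spec (B i) and Spec (B j) is tested on arbitrary rings C. *)
Definition zariski_sheaf (X : zfunctor) : Prop :=
  forall (A : comPzRingType) (n : nat) (a c : 'I_n -> A),
    \sum_i c i * a i = 1 ->
  forall (B : 'I_n -> comPzRingType) (l : forall i, {rmorphism A -> B i}),
    (forall i, is_localization (a i) (l i)) ->
  forall x : forall i, X (B i),
    (forall i j (C : comPzRingType) (f : {rmorphism B i -> C})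
        (g : {rmorphism B j -> C}),
      f \o l i =1 g \o l j -> fmap X f (x i) = fmap X g (x j)) ->
  exists! y : X A, forall i, fmap X (l i) y = x i.

Definition scheme (X : zfunctor) : Prop :=
  zariski_sheaf X /\
  forall (K : fieldType) (x : X K),
    exists (A : comPzRingType) (u : X A), open_immersion u /\ image_sub u x.

(* The diagonal is a closed immersion: the locus where x and y agree is V(I). *)
Definition separated (X : zfunctor) : Prop :=
  forall (A : comPzRingType) (x y : X A), exists I : set A,
    forall (B : comPzRingType) (f : {rmorphism A -> B}),
      fmap X f x = fmap X f y <-> (forall a, I a -> f a = 0).

(* P is the polynomial ring over the integers in the indeterminates x. *)
Definition polynomial_ring (n : nat) (P : comPzRingType) (x : 'I_n -> P) : Prop :=
  forall (B : comPzRingType) (b : 'I_n -> B),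
    exists2 f : {rmorphism P -> B}, (forall i, f (x i) = b i) &
      forall g : {rmorphism P -> B}, (forall i, g (x i) = b i) -> g =1 f.

Definition finitely_generated (A : comPzRingType) : Prop :=
  exists (n : nat) (P : comPzRingType) (x : 'I_n -> P) (p : {rmorphism P -> A}),
    polynomial_ring x /\ forall a, exists y, p y = a.

Definition finitely_presented (A : comPzRingType) : Prop :=
  exists (n : nat) (P : comPzRingType) (x : 'I_n -> P) (p : {rmorphism P -> A}),
  [/\ polynomial_ring x, forall a, exists y, p y = a
    & exists m (r : 'I_m -> P), forall y,
        p y = 0 <-> exists c : 'I_m -> P, y = \sum_i c i * r i].

Definition finite_type (X : zfunctor) : Prop :=
  exists (n : nat) (A : 'I_n -> comPzRingType) (u : forall i, X (A i)),
    (forall i, open_immersion (u i) /\ finitely_generated (A i)) /\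
    forall (K : fieldType) (x : X K), exists i, image_sub (u i) x.

Definition locally_finitely_presented (X : zfunctor) : Prop :=
  forall (K : fieldType) (x : X K), exists (A : comPzRingType) (u : X A),
    [/\ open_immersion u, finitely_presented A & image_sub u x].

(* Thickenings of order one suffice: the lifting property for an arbitrary
   nilpotent kernel follows by induction. *)
Definition formally_smooth (X : zfunctor) : Prop :=
  forall (A B : comPzRingType) (p : {rmorphism A -> B}),
    (forall b, exists a, p a = b) ->
    (forall a a', p a = 0 -> p a' = 0 -> a * a' = 0) ->
  forall y : X B, exists x : X A, fmap X p x = y.

Definition smooth (X : zfunctor) : Prop :=
  locally_finitely_presented X /\ formally_smooth X.

Definition empty_sub (X : zfunctor) (U : subfunctor X) : Prop :=
  forall (K : fieldType) (x : X K), ~ U K x.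

Definition connected (X : zfunctor) : Prop :=
  (exists (K : fieldType) (x : X K), True) /\
  forall U W : subfunctor X, open_sub U -> open_sub W ->
    (forall (K : fieldType) (x : X K), U K x \/ W K x) ->
    (forall (K : fieldType) (x : X K), ~ (U K x /\ W K x)) ->
    empty_sub U \/ empty_sub W.

Definition prime_ideal (A : comPzRingType) (P : set A) : Prop :=
  [/\ P 0 /\ ~ P 1,
      forall x y, P x -> P y -> P (x + y),
      forall a x, P x -> P (a * x)
    & forall x y, P (x * y) -> P x \/ P y].

(* dim X >= d, the dimension of a scheme being the supremum of the Krull
   dimensions of its affine opens. *)
Definition dim_ge (X : zfunctor) (d : nat) : Prop :=
  exists (A : comPzRingType) (u : X A), open_immersion u /\
  exists P : nat -> set A,
    (forall i, (i <= d)%N -> prime_ideal (P i)) /\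
    (forall i, (i < d)%N -> P i `<` P i.+1).

(* The dimension of a variety over the integers is understood relatively to
   Spec int, as the dimension of the fibres. *)
Definition positive_dimension (X : zfunctor) : Prop :=
  exists k : fieldType, dim_ge (base_change X k) 1.

(* Reducedness is not required: it follows from smoothness. *)
Definition variety (X : zfunctor) : Prop :=
  [/\ scheme X, separated X & finite_type X].

Definition natcard (T : Type) (A : set T) : nat := xget 0%N [set n | A #= `I_n].

Definition moebius (n : nat) : int :=
  if all (fun p => logn p n == 1%N) (primes n) then (-1) ^+ size (primes n) else 0.

(* M_k(X, q), where F m is meant to be the field with q ^ m elements. *)
Definition necklace (X : zfunctor) (F : nat -> finFieldType) (k : nat) : rat :=
  k%:R^-1 * \sum_(m <- divisors k)
    (moebius (k %/ m))%:~R * (natcard [set: X (F m)])%:R.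

Definition binom (x : rat) (j : nat) : rat := (\prod_(i < j) (x - i%:R)) / j`!%:R.

Definition has_field_degree (k K : fieldType) (f : {rmorphism k -> K}) (d : nat) :
    Prop :=
  exists b : 'I_d -> K, forall y, exists! c : {ffun 'I_d -> k},
    y = \sum_i f (c i) * b i.

Definition closed_point_of_degree (X : zfunctor) (k : fieldType) (d : nat)
    (x : scheme_point (base_change X k)) : Prop :=
  closed_point x /\ has_field_degree (pt x).2 d.

(* The number of closed points of degree d of X_k, counted up to same_point. *)
Definition num_closed_points (X : zfunctor) (k : fieldType) (d : nat) : nat :=
  xget 0%N [set N | exists s : 'I_N -> scheme_point (base_change X k),
    [/\ forall i, closed_point_of_degree d (s i),
        forall i j, same_point (s i) (s j) -> i = j
      & forall y, closed_point_of_degree d y -> exists i, same_point (s i) y]].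

(* The product of (1 - t ^ deg x)^-1 over the closed points x of X_k: the points
   of degree greater than n do not contribute to the coefficient of t ^ n. *)
Definition zeta (X : zfunctor) (k : fieldType) : fps rat :=
  Fps (fun n => fcoef
    (\prod_(1 <= d < n.+1) (1 - 't ^+ d)^-1 ^+ num_closed_points X k d) n).

Section Configurations.
Variables (T : Type) (Frob : T -> T) (n : nat).

(* With T the geometric points of X and Frob the Frobenius of T, these are the
   rational points of Conf_n X. *)
Definition conf : set (set T) := [set C | C #= `I_n /\ Frob @` C = C].

Definition frob_acts_as (C : set T) (s : 'S_n) : Prop :=
  exists e : 'I_n -> T,
    [/\ injective e, range e = C & forall i, Frob (e i) = e (s i)].

(* Well defined up to conjugacy only. *)
Definition frob_perm (C : set T) : 'S_n := xget 1%g [set s | frob_acts_as C s].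

Definition num_cycles (k : nat) (s : 'S_n) : nat :=
  #|[set c in porbits s | #|c| == k]%SET|.

Definition binomX (lambda : seq nat) (s : 'S_n) : nat :=
  (\prod_(1 <= k < (size lambda).+1) 'C(num_cycles k s, nth 0 lambda k.-1))%N.

End Configurations.

(* Main.v *)
Require Import Defs.
From HB Require Import structures.
From mathcomp Require Import all_boot all_order all_algebra all_fingroup.
From mathcomp Require Import all_solvable all_field.
From mathcomp Require Import ring.
From mathcomp Require Import boolp classical_sets functions cardinality fsbigop.

Set Implicit Arguments.
Unset Strict Implicit.
Unset Printing Implicit Defensive.
Import GRing.Theory.
Local Open Scope classical_set_scope.
Local Open Scope ring_scope.

(** Both sides count the same thing.  A Frobenius-stable set C of geometric points
    is a union of Frobenius orbits, and the k-cycles of sigma_C are the orbits of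
    length k contained in C; so the coefficient of t ^ n on the left is a sum over
    finite sets of orbits of total length n.  Choosing the orbits length by
    length, the left-hand side is the product over k of
      sum_j binomial(M_k, j) binomial(j, lambda_k) t ^ (k j)
        = binomial(M_k, lambda_k) t ^ (k lambda_k) (1 + t ^ k) ^ (M_k - lambda_k),
    with M_k the number of orbits of length k ([sum_stable_binomial] and
    [binomial_sum]).  Since (1 - t ^ 2k) / (1 - t ^ k) = 1 + t ^ k, the product of
    the (1 + t ^ k) ^ M_k is Z(t) / Z(t ^ 2), provided that M_k is also the number
    of closed points of degree k ([euler_ratio_eqmod]).  The infinite products are
    compared modulo t ^ (n + 1), where only orbits of bounded length intervene;
    these have finitely many elements in all, and the combinatorics takes place
    in a symmetric group.

    The geometric input is the identification of M_k with the two other numbers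
    of the statement.

    - M_k is the necklace polynomial: the fixed points of Frob ^ m are the points
      over the field with q ^ m elements ([phi_fixed]), because coordinates in a
      chart fixed by Frob ^ m lie in that field; one concludes by Moebius
      inversion ([necklaceE]).
    - M_k is the number of closed points of degree k
      ([num_closed_points_orbits]).  A closed point of degree k gives a geometric
      point by embedding its residue field, and two embeddings over the base
      field differ by a power of the Frobenius ([embeddings_frob_conjugate]).
      Conversely a geometric point of period k is defined over the field K with
      q ^ k elements, K is its residue field because every subring of K that
      contains its coordinates and the base field is all of K
      ([period_generates]), and its image is closed.

    Closedness has to be shown on every affine scheme Spec A mapping to the
    variety: the points of Spec A lying over the given closed point must be the
    zeros of an ideal, the ideal of all functions vanishing there.  That every zero
    of this ideal in a field lies over the closed point is
    [vanishing_ideal_zero], and openness of the complement follows because a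
    proper ideal has a zero in some field ([ideal_field_point]). *)

(** * Ring morphisms, quotients and localizations *)

(** A ring morphism is a total, single-valued subring of the product.  Maps out
    of finite fields are obtained in this way, with no presentation at hand. *)
Lemma rmorphism_of_rel (A B : comPzRingType) (G : A -> B -> Prop) :
  (forall a, exists b, G a b) -> (forall b, G 0 b -> b = 0) -> G 1 1 ->
  (forall a b a' b', G a b -> G a' b' -> G (a - a') (b - b')) ->
  (forall a b a' b', G a b -> G a' b' -> G (a * a') (b * b')) ->
  exists f : {rmorphism A -> B}, forall a, G a (f a).
Proof.
move=> totG G0 G1 GB GM.
have [f fG] := choice totG.
have uniqG a b b' : G a b -> G a b' -> b = b'.
  by move=> Gb Gb'; apply/subr0_eq/G0; rewrite -(subrr a); apply: GB.
have fB : zmod_morphism f by move=> a a'; apply: uniqG (fG _) (GB _ _ _ _ _ _).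
have fM : monoid_morphism f.
  by split=> [|a a']; [apply: uniqG (fG _) G1 | apply: uniqG (fG _) (GM _ _ _ _ _ _)].
pose g : {rmorphism A -> B} :=
  HB.pack f (GRing.isZmodMorphism.Build A B f fB)
            (GRing.isMonoidMorphism.Build A B f fM).
by exists g.
Qed.

Lemma rmorphism_factor (A B C : comPzRingType) (f : {rmorphism A -> C})
    (g : {rmorphism B -> C}) : injective g -> (forall a, exists b, g b = f a) ->
  exists h : {rmorphism A -> B}, forall a, g (h a) = f a.
Proof.
move=> gI fg; apply: (@rmorphism_of_rel A B (fun a b => g b = f a)) => //.
- by move=> b; rewrite rmorph0 -(rmorph0 g) => /gI.
- by rewrite !rmorph1.
- by move=> a b a' b'; rewrite !rmorphB => -> ->.
- by move=> a b a' b'; rewrite !rmorphM => -> ->.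
Qed.

Lemma comNzRing_of_neq0 (A : comPzRingType) : (1 : A) <> 0 ->
  exists A' : comNzRingType, A = A'.
Proof.
case: A => T c A1; set A := GRing.ComPzRing.Pack c in A1 *.
have nzA : (1 : A) != 0 by apply/eqP.
by exists (HB.pack T A (GRing.PzSemiRing_isNonZero.Build A nzA) : comNzRingType).
Qed.

Definition is_ideal (A : comPzRingType) (I : set A) : Prop :=
  [/\ I 0, forall a b, I a -> I b -> I (a + b) & forall a b, I b -> I (a * b)].

Definition gen_ideal (A : comPzRingType) (S : set A) : set A :=
  [set a | exists n (b s : 'I_n -> A), (forall i, S (s i)) /\ a = \sum_i b i * s i].

Lemma gen_ideal_sub (A : comPzRingType) (S : set A) : S `<=` gen_ideal S.
Proof.
by move=> a Sa; exists 1, (fun=> 1), (fun=> a); split; rewrite ?big_ord1 ?mul1r.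
Qed.

Lemma is_ideal_gen (A : comPzRingType) (S : set A) : is_ideal (gen_ideal S).
Proof.
split.
- by exists 0, (fun=> 0), (fun=> 0); split=> [[] //|]; rewrite big_ord0.
- move=> _ _ [n [b [s [Ss ->]]]] [m [b' [s' [Ss' ->]]]].
  exists (n + m)%N, (fun i => match fintype.split i with inl j => b j | inr j => b' j end),
    (fun i => match fintype.split i with inl j => s j | inr j => s' j end).
  split=> [i|]; first by case: (fintype.split i).
  rewrite big_split_ord /=; congr (_ + _); apply: eq_bigr => i _.
    by rewrite -[lshift _ _]/(unsplit (inl i)) unsplitK.
  by rewrite -[rshift _ _]/(unsplit (inr i)) unsplitK.
move=> a _ [n [b [s [Ss ->]]]]; exists n, (fun i => a * b i), s; split=> //.
by rewrite mulr_sumr; apply: eq_bigr => i _; rewrite mulrA.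
Qed.

Lemma quotient_ring (A : comPzRingType) (I : set A) : is_ideal I -> ~ I 1 ->
  exists (Q : comNzRingType) (f : {rmorphism A -> Q}),
    (forall x, exists a, f a = x) /\ (forall a, f a = 0 <-> I a).
Proof.
move=> idI I1; have [A' eA] : exists A' : comNzRingType, A = A'.
  apply: comNzRing_of_neq0 => A10; case: idI => I0 _ _.
  by apply: I1; rewrite A10.
move: I idI I1; rewrite {A}eA; move: A' => A I [I0 ID IM] I1.
pose P : {pred A} := fun a => `[< I a >].
have PE a : (a \in P) = `[< I a >] by [].
have clP : idealr_closed P.
  split=> [||a u v]; rewrite ?PE; [exact/asboolP | exact/asboolPn|].
  by move=> /asboolP Iu /asboolP Iv; apply/asboolP/ID => //; apply: IM.
pose k := isIdealr.Build A P clP.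
pose J : idealr A := HB.pack P k.
exists ({ideal_quot J}), (\pi_({ideal_quot J}))%qT; split=> [x|a].
  by exists (generic_quotient.repr x); exact: reprK.
have pi0 : \pi_({ideal_quot J})%qT 0 = 0 := rmorph0 _.
rewrite -pi0; split=> [/eqP|Ia]; last first.
  by apply/eqP; rewrite -Quotient.idealrBE subr0; apply/asboolP.
by rewrite -Quotient.idealrBE subr0 => /asboolP.
Qed.
Lemma field_of_comNzRing (Q : comNzRingType) :
  (forall x : Q, x != 0 -> exists y, y * x = 1) ->
  exists K : fieldType, (Q : comPzRingType) = (K : comPzRingType).
Proof.
move=> invQ; have /choice[inv invP] (x : Q) :
    exists y, (x != 0 -> y * x = 1) /\ (x = 0 -> y = 0).
  have [->|/[dup] x0 /invQ[y yx]] := eqVneq x 0; first by exists 0.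
  by exists y; split=> // /eqP; rewrite (negPf x0).
have mulVf x : x != 0 -> inv x * x = 1 by case: (invP x).
have inv0 : inv 0 = 0 by case: (invP 0) => _; apply.
case: Q invQ inv invP mulVf inv0 => T c invQ inv invP mulVf inv0.
set Q := GRing.ComNzRing.Pack c in invQ inv invP mulVf inv0 *.
by exists (HB.pack T Q (GRing.ComNzRing_isField.Build Q mulVf inv0) : fieldType).
Qed.

(** An ideal not containing 1 has a zero in some field: the residue field of a
    maximal ideal above it. *)
Lemma ideal_field_point (A : comPzRingType) (I : set A) : is_ideal I -> ~ I 1 ->
  exists (L : fieldType) (g : {rmorphism A -> L}), forall a, I a -> g a = 0.
Proof.
move=> idI I1.
(* The empty chain forces a property of I `|` X rather than of X. *)
pose P (X : set A) := is_ideal (I `|` X) /\ ~ (I `|` X) 1.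
have [] := @Zorn_bigcup A P.
  move=> F PF Ftot; split; last first.
    by case=> // -[X FX X1]; have [_ []] := PF X FX; right.
  have [I0 ID IM] := idI.
  split; first by left.
    move=> a b [Ia|[X FX Xa]] [Ib|[Y FY Yb]].
    - by left; apply: ID.
    - have [[_ /(_ a b)XD _] _] := PF Y FY.
      by case: XD; [left|right|left|right; exists Y].
    - have [[_ /(_ a b)XD _] _] := PF X FX.
      by case: XD; [right|left|left|right; exists X].
    - have [XY|YX] := Ftot X Y FX FY.
        have [[_ /(_ a b)XD _] _] := PF Y FY.
        by case: XD; [right; apply: XY|right|left|right; exists Y].
      have [[_ /(_ a b)XD _] _] := PF X FX.
      by case: XD; [right|right; apply: YX|left|right; exists X].
  move=> a b [Ib|[X FX Xb]]; first by left; apply: IM.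
  have [[_ _ /(_ a b)XM] _] := PF X FX.
  by case: XM; [right|left|right; exists X].
move=> X [[idM M1] maxX]; set M := I `|` X in idM M1.
have [Q [f [fsurj fM]]] := quotient_ring idM M1.
have [x|K eK] := @field_of_comNzRing Q.
  have [a <-] := fsurj x => fa0; have [M0 MD MM] := idM.
  pose N : set A := [set z | exists b c, M b /\ z = b + c * a].
  have MN : M `<=` N by move=> b Mb; exists b, 0; rewrite mul0r addr0.
  have idN : is_ideal N.
    split; first exact: MN.
      move=> _ _ [b [c [Mb ->]]] [b' [c' [Mb' ->]]]; exists (b + b'), (c + c').
      by split; [apply: MD | rewrite mulrDl addrACA].
    move=> d _ [b [c [Mb ->]]]; exists (d * b), (d * c).
    by split; [apply: MM | rewrite mulrDr mulrA].
  have Na : N a by exists 0, 1; rewrite mul1r add0r.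
  have INE : I `|` N = N by apply/setUidPr => b Ib; apply: MN; left.
  have XN : X `<` N.
    split=> [b Xb|/(_ a Na) Xa]; first by apply: MN; right.
    by move/eqP: fa0; apply; apply/fM; right.
  have : N 1.
    by apply: contrapT => N1; apply: (maxX _ XN); rewrite /P INE.
  move=> [b [c [Mb e]]]; exists (f c); rewrite -(rmorph1 f) e rmorphD rmorphM.
  by rewrite (fM b).2 // add0r.
have H (R : comPzRingType) : (Q : comPzRingType) = R ->
    exists g : {rmorphism A -> R}, forall a, I a -> g a = 0.
  by move=> <-; exists f => a Ia; apply/(fM a); left.
by exists K; apply: H.
Qed.

(** The localization of A at the powers of s, as the quotient of A[X] by s X - 1.
    Its elements become images of elements of A when multiplied by a power of s. *)
Lemma localization (A : comPzRingType) (s : A) (L : fieldType)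
    (g : {rmorphism A -> L}) : g s != 0 ->
  exists (B : comPzRingType) (l : {rmorphism A -> B}),
  [/\ unit_elt (l s),
      forall z, exists N a, l s ^+ N * z = l a
    & forall (L' : fieldType) (g' : {rmorphism A -> L'}), g' s != 0 ->
        exists h : {rmorphism B -> L'}, forall a, h (l a) = g' a].
Proof.
move=> gs0; have [A' eA] : exists A' : comNzRingType, A = A'.
  apply: comNzRing_of_neq0 => A10; move: gs0.
  by rewrite -[s]mul1r A10 mul0r rmorph0 eqxx.
move: s g gs0; rewrite {A}eA; move: A' => A s g gs0.
pose r : {poly A} := s *: 'X - 1.
pose I : set {poly A} := [set z | exists c, z = c * r].
pose ev (L' : fieldType) (g' : {rmorphism A -> L'}) : {rmorphism {poly A} -> L'} :=
  horner_morph (fun x => mulrC (g' s)^-1 (g' x)).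
have evM (L' : fieldType) (g' : {rmorphism A -> L'}) (gs : g' s != 0) :
    ev L' g' r = 0.
  rewrite rmorphB rmorph1 -mul_polyC rmorphM /=.
  by rewrite horner_morphC horner_morphX mulfV // subrr.
have idI : is_ideal I.
  split=> [|_ _ [c ->] [c' ->]|a _ [c ->]]; first by exists 0; rewrite mul0r.
    by exists (c + c'); rewrite mulrDl.
  by exists (a * c); rewrite mulrA.
have I1 : ~ I 1.
  move=> [c] /(congr1 (ev L g)).
  by rewrite rmorphM evM // mulr0 rmorph1 => /eqP; rewrite oner_eq0.
have [B [f [fsurj fI]]] := quotient_ring idI I1.
pose l : {rmorphism A -> B} := f \o polyC.
have lX : l s * f 'X = 1.
  apply/subr0_eq; have -> : l s * f 'X - 1 = f r.
    by rewrite /r -mul_polyC rmorphB rmorph1 rmorphM.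
  by apply/fI; exists 1; rewrite mul1r.
exists B, l; split; first by exists (f 'X).
  move=> z; have [p <-] := fsurj z.
  exists (size p), (\sum_(i < size p) p`_i * s ^+ (size p - i)).
  have -> : f p = \sum_(i < size p) l p`_i * f 'X ^+ i.
    rewrite -{1}(coefK p) poly_def rmorph_sum; apply: eq_bigr => i _.
    by rewrite -mul_polyC rmorphM rmorphXn.
  rewrite mulr_sumr rmorph_sum; apply: eq_bigr => i _.
  rewrite rmorphM rmorphXn mulrCA; congr (_ * _).
  by rewrite -{1}(subnK (ltnW (ltn_ord i))) exprD -mulrA -exprMn lX expr1n mulr1.
move=> L' g' gs.
have [] := @rmorphism_of_rel B L' (fun z w => exists p, f p = z /\ ev L' g' p = w).
- by move=> z; have [p <-] := fsurj z; exists (ev L' g' p), p.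
- by move=> _ [p [/fI[c ->] <-]]; rewrite rmorphM evM // mulr0.
- by exists 1; rewrite !rmorph1.
- by move=> _ _ _ _ [p [<- <-]] [p' [<- <-]]; exists (p - p'); rewrite !rmorphB.
- by move=> _ _ _ _ [p [<- <-]] [p' [<- <-]]; exists (p * p'); rewrite !rmorphM.
move=> h hP; exists h => a.
have [p [/subr0_eq fp <-]] : exists p, f p - l a = 0 /\ ev L' g' p = h (l a).
  by have [p [e <-]] := hP (l a); exists p; rewrite e subrr.
have [c e] : I (p - a%:P) by apply/fI; rewrite rmorphB fp subrr.
have -> : p = c * r + a%:P by rewrite -e subrK.
by rewrite rmorphD rmorphM evM // mulr0 add0r; apply: horner_morphC.
Qed.
(** * Finite fields inside an algebraic closure *)

Lemma card_finField_gt1 (K : finFieldType) : (1 < #|K|)%N.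
Proof. by rewrite (cardD1 0) (cardD1 1) !inE oner_eq0. Qed.

Lemma finFieldType_of_enum (K : fieldType) (T : finType) (f : K -> T) (g : T -> K) :
  cancel f g -> exists K' : finFieldType, (K = K' :> fieldType) /\ (#|K'| <= #|T|)%N.
Proof.
case: K f g => S c f g fK; set K := GRing.Field.Pack c in f g fK *.
pose C : countType := HB.pack S K (PCanIsCountable (can_pcan fK)).
pose K' : finFieldType :=
  HB.pack S K (PCanIsCountable (can_pcan fK)) (@CanIsFinite C T f g fK).
by exists K'; split; last exact: (@leq_card K' T f (can_inj fK)).
Qed.

Lemma frobenius_pow (R : comNzRingType) (p n : nat) : p \in [pchar R] ->
  exists f : {rmorphism R -> R}, forall y, f y = y ^+ (p ^ n).
Proof.
move=> pcharRp; elim: n => [|n [f fE]]; first by exists idfun => y; rewrite expn0 expr1.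
exists (pFrobenius_aut pcharRp \o f) => y.
by rewrite /= fE pFrobenius_autE -exprM expnSr.
Qed.

Lemma prime_field_embedding (R : comNzRingType) (p : nat) : p \in [pchar R] ->
  exists f : {rmorphism 'F_p -> R}, True.
Proof.
move=> pcharRp; have p_pr := pcharf_prime pcharRp.
have natE (n : nat) : ((n%:R : 'F_p) : nat)%:R = n%:R :> R.
  by rewrite val_Fp_nat // GRing.natr_mod_pchar.
have [] := @rmorphism_of_rel 'F_p R (fun a b => exists z : int, a = z%:~R /\ b = z%:~R).
- by move=> a; exists (a : nat)%:R, (Posz a); split=> //; apply/esym/(natr_Zp a).
- move=> _ [z [e ->]]; have intE (m : nat) : (m%:R : 'F_p) = 0 -> (m%:R : R) = 0.
    by move=> m0; rewrite -natE m0.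
  case: z e => m /esym; first exact: intE.
  by rewrite NegzE !mulrNz -!pmulrn => /eqP; rewrite oppr_eq0 => /eqP/intE ->; rewrite oppr0.
- by exists 1.
- by move=> _ _ _ _ [z [-> ->]] [z' [-> ->]]; exists (z - z'); rewrite !intrB.
- by move=> _ _ _ _ [z [-> ->]] [z' [-> ->]]; exists (z * z'); rewrite !intrM.
by move=> f _; exists f.
Qed.

(** Finite subgroups of the units of a field are cyclic. *)
Lemma mul_closed_cyclic (K : finFieldType) (E : set K) :
    E 1 -> (forall x y, E x -> E y -> E (x * y)) ->
  exists2 g, E g & forall x, E x -> x != 0 -> exists i, x = g ^+ i.
Proof.
move=> E1 EM; pose G := [set u : {unit K} | `[< E (val u) >]]%SET.
have gG : group_set G.
  apply/group_setP; split; first by rewrite inE; exact: (asboolT E1).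
  move=> u v; rewrite !inE => Eu Ev.
  rewrite [val _]FinRing.val_unitM.
  exact: EM.
have /cyclicP[g defG] := field_unit_group_cyclic (Group gG).
exists (val g).
  have : g \in Group gG by rewrite defG cycle_id.
  by rewrite inE => Eg; exact: (asboolW Eg).
move=> x Ex; rewrite -unitfE => Ux; have : FinRing.unit K Ux \in Group gG.
  by rewrite inE; exact: (asboolT Ex).
by rewrite defG => /cycleP[i /(congr1 val)]; rewrite FinRing.val_unitX; exists i.
Qed.

Lemma finField_generator (K : finFieldType) :
  exists g : K, forall x, exists P : {poly int}, x = (map_poly intr P).[g].
Proof.
have [//|//|g _ gP] := @mul_closed_cyclic K setT; exists g => x.
have [->|/gP[//|i ->]] := eqVneq x 0; first by exists 0; rewrite rmorph0 horner0.
by exists 'X^i; rewrite rmorphXn /= map_polyX hornerXn.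
Qed.

(** The morphism is evaluation at a root of the minimal polynomial of a generator. *)
Lemma finField_embedding (k0 : fieldType) (K : finFieldType) (L : closedFieldType)
    (iota : {rmorphism k0 -> K}) (j : {rmorphism k0 -> L}) :
  exists e : {rmorphism K -> L}, forall c, e (iota c) = j c.
Proof.
have [g gP] := finField_generator K.
have mapz (F : fieldType) (h : {rmorphism k0 -> F}) (P : {poly int}) :
    map_poly h (map_poly intr P) = map_poly intr P.
  by rewrite -map_poly_comp; apply: eq_map_poly => z /=; rewrite rmorph_int.
have genP x : exists P : {poly k0}, (map_poly iota P).[g] = x.
  by have [P ->] := gP x; exists (map_poly intr P); rewrite mapz.
pose bad n := `[< exists P : {poly k0},
  [/\ P != 0, root (map_poly iota P) g & size P = n] >].
have exbad : exists n, bad n.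
  pose P0 : {poly k0} := 'X^#|K| - 'X.
  have c1 := card_finField_gt1 K.
  exists (size P0); apply/asboolP; exists P0; split=> //.
    by rewrite -size_poly_eq0 size_polyDl ?size_polyXn // size_polyN size_polyX.
  by rewrite rmorphB rmorphXn /= map_polyX /root !hornerE expf_card subrr.
have [n /asboolP[P [P0 Pg sP]] minP] := ex_minnP exbad.
have dvdP Q : root (map_poly iota Q) g -> P %| Q.
  move=> Qg; apply: contraT => ndvd.
  have : (n <= size (Q %% P)%R)%N.
    apply: minP; apply/asboolP; exists (Q %% P); split=> //.
    rewrite [Q in root (map_poly _ Q)](divp_eq Q P) rmorphD rmorphM in Qg.
    by move: Qg; rewrite /root hornerD hornerM (rootP Pg) mulr0 add0r.
  by rewrite -sP leqNgt ltn_modp P0.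
have /closed_rootP[y Py] : size (map_poly j P) != 1.
  rewrite size_map_poly; apply/negP => /size_poly1P[c c0 e].
  by move: Pg; rewrite e map_polyC /root hornerC fmorph_eq0 (negPf c0).
have [] := @rmorphism_of_rel K L
  (fun x z => exists Q, (map_poly iota Q).[g] = x /\ (map_poly j Q).[y] = z).
- by move=> x; have [Q Qx] := genP x; exists (map_poly j Q).[y], Q.
- move=> _ [Q [/rootP/dvdP/dvdpP[R ->] <-]].
  by rewrite rmorphM hornerM (rootP Py) mulr0.
- by exists 1; rewrite !rmorph1 !hornerC.
- by move=> _ _ _ _ [Q [<- <-]] [R [<- <-]]; exists (Q - R); rewrite !rmorphB !hornerE.
- by move=> _ _ _ _ [Q [<- <-]] [R [<- <-]]; exists (Q * R); rewrite !rmorphM !hornerE.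
move=> e eP; exists e => c; have [Q [Qc <-]] := eP (iota c).
have /dvdP/dvdpP[R /eqP] : root (map_poly iota (Q - c%:P)) g.
  by rewrite /root rmorphB hornerD hornerN /= map_polyC hornerC Qc subrr.
rewrite subr_eq => /eqP ->; rewrite rmorphD rmorphM hornerD hornerM (rootP Py).
by rewrite mulr0 add0r /= map_polyC hornerC.
Qed.

Lemma finField_image (K : finFieldType) (L : fieldType) (e : {rmorphism K -> L}) y :
  y ^+ #|K| = y -> exists z, e z = y.
Proof.
move=> yK; have /(congr1 (fun P => (map_poly e P).[y])) := finField_genPoly K.
rewrite rmorphB rmorphXn /= map_polyX !hornerE yK subrr rmorph_prod horner_prod.
move/esym/eqP; rewrite prodf_seq_eq0 => /hasP[z _ /=].
rewrite rmorphB /= map_polyX map_polyC !hornerE subr_eq0 => /eqP ->.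
by exists z.
Qed.
Section Frobenius.
Variables (k : finFieldType) (L : fieldType) (j : {rmorphism k -> L}).
Variables (F : {rmorphism L -> L}) (FE : forall y, F y = y ^+ #|k|).

Lemma iter_frob i y : iter i F y = y ^+ (#|k| ^ i).
Proof.
elim: i => [|i IHi] /=; first by rewrite expn0 expr1.
by rewrite IHi FE -exprM expnSr.
Qed.

Lemma frob_inc c : F (j c) = j c.
Proof. by rewrite FE -rmorphXn expf_card. Qed.

Lemma iter_frob_inc i c : iter i F (j c) = j c.
Proof. by elim: i => //= i ->; exact: frob_inc. Qed.

Lemma frob_invariant_poly (P : {poly L}) :
  map_poly F P = P -> exists P0, P = map_poly j P0.
Proof.
move=> FP; have /choice[c cE] i : exists c, j c = P`_i.
  by apply: finField_image; rewrite -FE -{2}FP coef_map.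
exists (\poly_(i < size P) c i); apply/polyP => i; rewrite coef_map coef_poly /=.
by case: ltnP => [_|le_Pi]; [rewrite cE | rewrite rmorph0 nth_default].
Qed.

Lemma frob_root (P : {poly k}) y :
  root (map_poly j P) y -> root (map_poly j P) (F y).
Proof.
move=> /rootP Py; apply/rootP; transitivity ((map_poly F (map_poly j P)).[F y]).
  congr (_.[_]); apply/polyP => i; rewrite !coef_map /=.
  by rewrite frob_inc.
by rewrite horner_map Py rmorph0.
Qed.

(** All conjugates of y are roots of the polynomials over k that vanish at y. *)
Lemma frob_conjugates_free d y (P : {poly k}) : uniq (traject F y d) ->
  (size P <= d)%N -> root (map_poly j P) y -> P = 0.
Proof.
move=> uniq_y sP Py; apply/eqP; apply: contraT => P0.
have : (size (traject F y d) < size (map_poly j P))%N.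
  apply: max_poly_roots => //; first by rewrite map_poly_eq0.
  apply/allP => _ /trajectP[i _ ->].
  by elim: i => //= i; exact: frob_root.
by rewrite size_traject size_map_poly ltnNge sP.
Qed.

(** The product of the X - y ^ (q ^ i) has coefficients in k, so that its roots
    are permuted by every embedding over k. *)
Lemma embeddings_frob_conjugate (K : finFieldType) (d : nat)
    (iota : {rmorphism k -> K}) (e e' : {rmorphism K -> L}) :
  (0 < d)%N -> #|K| = (#|k| ^ d)%N ->
  (forall c, e (iota c) = j c) -> (forall c, e' (iota c) = j c) ->
  exists i, forall z, e' z = iter i F (e z).
Proof.
move=> d0 cardK eE e'E; have [g gP] := finField_generator K.
pose P := \prod_(0 <= i < d) ('X - (iter i F (e g))%:P).
have [|P0 P0E] := @frob_invariant_poly P.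
  rewrite rmorph_prod /P; under eq_bigr => i _.
    rewrite rmorphB /= map_polyX map_polyC /= -[F (iter i _ _)]iterS.
  over.
  case: d d0 cardK {P} => // d _ cardK; rewrite [RHS]big_nat_recl //.
  by rewrite big_nat_recr //= -[F (iter d _ _)]iterS iter_frob -cardK -rmorphXn expf_card mulrC.
have map_iota (h : {rmorphism K -> L}) : (forall c, h (iota c) = j c) ->
    forall x, (map_poly j P0).[h x] = h (map_poly iota P0).[x].
  move=> hE x; rewrite -horner_map; congr (_.[_]); apply/polyP => i.
  by rewrite !coef_map /= hE.
have : P.[e' g] == 0.
  rewrite P0E map_iota //; suff -> : (map_poly iota P0).[g] = 0 by rewrite rmorph0.
  apply: (fmorph_inj e); rewrite -map_iota // -P0E rmorph0; apply/eqP.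
  rewrite /P horner_prod big_ltn // hornerXsubC subrr mul0r //.
rewrite horner_prod prodf_seq_eq0 => /hasP[i _ /=].
rewrite hornerXsubC subr_eq0 => /eqP e'g; exists i => z.
have [Q ->] := gP z; rewrite -!horner_map e'g iter_frob.
have mapz (h : {rmorphism K -> L}) : map_poly h (map_poly intr Q) = map_poly intr Q.
  by rewrite -map_poly_comp; apply: eq_map_poly => x /=; rewrite rmorph_int.
rewrite !mapz -!iter_frob; elim: i {e'g} => //= i <-.
rewrite -horner_map; congr (_.[_]).
by rewrite -map_poly_comp; apply: eq_map_poly => x /=; rewrite rmorph_int.
Qed.

End Frobenius.

Lemma card_le_expf_id (K : finFieldType) n :
  (1 < n)%N -> (forall x : K, x ^+ n = x) -> (#|K| <= n)%N.
Proof.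
move=> n1 Kn; pose P : {poly K} := 'X^n - 'X.
have sP : size P = n.+1 by rewrite size_polyDl ?size_polyXn // size_polyN size_polyX.
have : (size (enum K) < size P)%N.
  apply: max_poly_roots; last exact: enum_uniq.
    by rewrite -size_poly_eq0 sP.
  by apply/allP => x _; rewrite /root !hornerE Kn subrr.
by rewrite sP -cardE.
Qed.

Section FiniteExtension.
Variables (k K : finFieldType) (iota : {rmorphism k -> K}).
Variables (F : {rmorphism K -> K}) (FE : forall y, F y = y ^+ #|k|).

(** With g a cyclic generator of E and e its number of conjugates, the powers
    1, g, ..., g ^ (e - 1) are linearly independent over k, and the q ^ e-power map
    fixes g, hence all of E. *)
Lemma finite_subextension (E : set K) :
  E 1 -> (forall x y, E x -> E y -> E (x - y)) ->
  (forall x y, E x -> E y -> E (x * y)) -> (forall c, E (iota c)) ->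
  exists e, [/\ (0 < e)%N, forall x, E x -> iter e F x = x
    & exists b : 'I_e -> K,
        injective (fun c : {ffun 'I_e -> k} => \sum_i iota (c i) * b i) /\
        forall c : {ffun 'I_e -> k}, E (\sum_i iota (c i) * b i)].
Proof.
move=> E1 EB EM Ek; have [g Eg gP] := mul_closed_cyclic E1 EM.
have E0 : E 0 by rewrite -(subrr 1); apply: EB.
have ED x y : E x -> E y -> E (x + y).
  by move=> Ex Ey; rewrite -[y]opprK -[- y]sub0r; apply/EB/EB.
have EX n : E (g ^+ n) by elim: n => [|n IHn]; rewrite ?expr0 // exprS; apply: EM.
exists (fingraph.order F g); split; first exact: fingraph.order_gt0.
  move=> x Ex; have [->|/(gP _ Ex)[i ->]] := eqVneq x 0.
    by rewrite (iter_frob FE) expr0n expn_eq0 (gtn_eqF (ltnW (card_finField_gt1 k))).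
  rewrite (iter_frob FE) -exprM mulnC exprM -(iter_frob FE) iter_order //.
  exact: fmorph_inj.
exists (fun i => g ^+ i); split=> [c c'|c]; last first.
  by apply: big_ind => // i _; apply: EM.
move=> ecc'; pose P := rVpoly (\row_i (c i - c' i)).
have P0 : P = 0.
  apply: (@frob_conjugates_free k K iota F FE (fingraph.order F g) g).
  - exact: orbit_uniq.
  - exact: size_poly.
  rewrite /root (@horner_coef_wide _ (fingraph.order F g)); last first.
    by rewrite size_map_poly; exact: size_poly.
  move/eqP: ecc'; rewrite -subr_eq0 -sumrB; congr (_ == _); apply: eq_bigr => i _.
  by rewrite coef_map coef_rVpoly_ord mxE /= rmorphB mulrBl.
apply/ffunP => i; apply/subr0_eq.
by have := coef_rVpoly_ord (\row_i (c i - c' i)) i; rewrite -/P P0 coef0 mxE.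
Qed.

Lemma finite_field_degree d : #|K| = (#|k| ^ d)%N -> has_field_degree iota d.
Proof.
move=> cardK; have [||||e [e0 eK [b [bI _]]]] := @finite_subextension setT => //.
have cardb : #|{ffun 'I_e -> k}| = (#|k| ^ e)%N by rewrite card_ffun card_ord.
have lee : (#|k| ^ e <= #|K|)%N by rewrite -cardb; exact: leq_card bI.
have gee : (#|K| <= #|k| ^ e)%N.
  apply: card_le_expf_id => [|x]; last by rewrite -(iter_frob FE) eK.
  by rewrite -(exp1n e) ltn_exp2r // card_finField_gt1.
have de : d = e.
  by apply: (@expnI #|k|); rewrite ?card_finField_gt1 // -cardK; apply/eqP; rewrite eqn_leq gee.
rewrite de; exists b => y.
have /codomP[c ->] : y \in codom (fun c : {ffun 'I_e -> k} => \sum_i iota (c i) * b i).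
  by apply: inj_card_onto; rewrite // cardb.
by exists c; split=> // c' /bI.
Qed.

End FiniteExtension.

Lemma finite_of_field_degree (k : finFieldType) (K : fieldType)
    (iota : {rmorphism k -> K}) d : has_field_degree iota d ->
  exists K' : finFieldType, (K = K' :> fieldType) /\ #|K'| = (#|k| ^ d)%N.
Proof.
move=> [b bP]; have /choice[f fE] (y : K) : exists c : {ffun 'I_d -> k},
    y = \sum_i iota (c i) * b i by have [c []] := bP y; exists c.
pose g (c : {ffun 'I_d -> k}) := \sum_i iota (c i) * b i.
have fK : cancel f g by move=> y; rewrite /g -fE.
have gK : cancel g f.
  move=> c; have [c' [_ uc]] := bP (g c).
  by rewrite -(uc (f (g c))) ?(uc c) // -fE.
have [K' [eK _]] := finFieldType_of_enum fK.
exists K'; split=> //; rewrite -[in RHS](card_ord d) -card_ffun.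
clear fE; clearbody g; clear bP b; move: f g fK gK.
move: {iota} eK => -> f g fK gK.
exact: (bij_eq_card (Bijective fK gK)).
Qed.
(** * Field-valued points of a variety *)

Fixpoint iter_rmorphism (R : comPzRingType) (f : {rmorphism R -> R}) m :
  {rmorphism R -> R} := if m is n.+1 then f \o iter_rmorphism f n else idfun.

Lemma iter_rmorphismE (R : comPzRingType) (f : {rmorphism R -> R}) m :
  iter_rmorphism f m =1 iter m f.
Proof. by elim: m => //= m IHm x; rewrite /= IHm. Qed.

Lemma fmap_iter (X : zfunctor) (R : comPzRingType) (f : {rmorphism R -> R}) m
  (x : X R) : fmap X (iter_rmorphism f m) x = iter m (fmap X f) x.
Proof. by elim: m => [|m IHm] /=; rewrite ?fmap_id // fmap_comp IHm. Qed.

Lemma eq_fmap (X : zfunctor) (A B : comPzRingType) (f g : {rmorphism A -> B})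
  (x : X A) : f =1 g -> fmap X f x = fmap X g x.
Proof. by move/rmorphism_ext ->. Qed.

Lemma separated_fmap_inj (X : zfunctor) (A B : comPzRingType)
  (f : {rmorphism A -> B}) : separated X -> injective f -> injective (fmap X f).
Proof.
move=> sepX fI x y fxy; have [I IP] := sepX A x y.
have /IP I0 := fxy; rewrite -(fmap_id x) -(fmap_id y); apply/(IP A idfun) => a Ia.
by apply: fI; rewrite rmorph0 I0.
Qed.

Definition affine_chart (X : zfunctor) (A : comPzRingType) (u : X A) : Prop :=
  open_immersion u /\ finitely_generated A.

Lemma chart_of_point (X : zfunctor) : finite_type X ->
  forall (K : fieldType) (x : X K), exists (A : comPzRingType) (u : X A),
    affine_chart u /\ Defs.image_sub u x.
Proof.
move=> [n [A [u [uP ucov]]]] K x; have [i xi] := ucov K x.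
by exists (A i), (u i); split; [exact: uP | exact: xi].
Qed.

(** Descent of points along K -> L: coordinates in a chart, being determined by
    the point, are fixed by every automorphism fixing the point. *)
Lemma fixed_point_descends (X : zfunctor) (K : comPzRingType) (L : fieldType)
    (e : {rmorphism K -> L}) (s : {rmorphism L -> L}) (x : X L) :
  finite_type X -> injective e -> (forall y, s y = y -> exists z, e z = y) ->
  fmap X s x = x -> exists y, fmap X e y = x.
Proof.
move=> ftX eI sP sx; have [A [u [[[umono _] _] [h hu]]]] := chart_of_point ftX x.
have sh : s \o h =1 h by apply: umono; rewrite fmap_comp hu.
have [h' h'E] := rmorphism_factor eI (fun a => sP _ (sh a)).
by exists (fmap X h' u); rewrite -fmap_comp -hu; apply: eq_fmap.
Qed.

Lemma finitely_generated_ext (A : comPzRingType) : finitely_generated A ->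
  exists n (a : 'I_n -> A), forall (B : comPzRingType) (f g : {rmorphism A -> B}),
    (forall i, f (a i) = g (a i)) -> f =1 g.
Proof.
move=> [n [P [x [p [Px psurj]]]]]; exists n, (p \o x) => B f g fg a.
have [b _ bP] := Px B (fun i => f (p (x i))).
have [y <-] := psurj a.
by rewrite [LHS](bP (f \o p)) // [RHS](bP (g \o p)) // => i; rewrite /= -fg.
Qed.

Lemma finite_points (X : zfunctor) (K : finFieldType) : finite_type X ->
  finite_set [set: X K].
Proof.
move=> [n [A [u [uP ucov]]]].
suff finU i : finite_set [set x : X K | Defs.image_sub (u i) x].
  apply: sub_finite_set (@bigcup_finite _ _ [set: 'I_n] _ _ (fun i _ => finU i)) => //.
  by move=> x _; have [i xi] := ucov K x; exists i.
have [m [a aP]] := finitely_generated_ext (uP i).2; set S := [set x | _].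
have /choice[f fP] (x : X K) : exists c : {ffun 'I_m -> K}, S x ->
    exists2 h : {rmorphism A i -> K}, fmap X h (u i) = x & forall l, h (a l) = c l.
  have [[h hu]|nSx] := pselect (S x); last by exists [ffun=> 0].
  by exists [ffun l => h (a l)] => _; exists h => // l; rewrite ffunE.
have fI : {in S &, injective f}.
  move=> x y /set_mem Sx /set_mem Sy efxy.
  have [h hu hE] := fP x Sx; have [h' hu' h'E] := fP y Sy.
  by rewrite -hu -hu'; apply/eq_fmap/aP => l; rewrite hE h'E efxy.
by rewrite -(eq_finite_set (inj_card_eq fI)); exact: finite_finset.
Qed.

Lemma generate_unit_point (A : comPzRingType) (L : fieldType) (g : {rmorphism A -> L})
  (I : set A) : generate_unit g I -> exists2 s, I s & g s != 0.
Proof.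
move=> [n [b [s [Is bs]]]]; apply: contrapT => g0.
move/eqP: bs; rewrite big1 ?(eq_sym 0) ?oner_eq0 // => i _.
have [->|gs] := eqVneq (g (s i)) 0; first by rewrite mulr0.
by case: g0; exists (s i).
Qed.

Lemma point_generate_unit (A B : comPzRingType) (g : {rmorphism A -> B}) (I : set A) s :
  I s -> unit_elt (g s) -> generate_unit g I.
Proof.
move=> Is [c gc]; exists 1, (fun=> c), (fun=> s); split=> //.
by rewrite big_ord1 mulrC.
Qed.

(** An ideal of a field generates the unit ideal of an extension as soon as it is
    nonzero, and then it is already the unit ideal. *)
Lemma open_sub_descends (X : zfunctor) (U : subfunctor X) (K L : fieldType)
    (f : {rmorphism K -> L}) (x : X K) :
  open_sub U -> U L (fmap X f x) -> U K x.
Proof.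
move=> openU UL; have [I IP] := openU K x.
have [s Is] : exists2 s, I s & f s != 0 by apply/generate_unit_point/IP.
rewrite fmorph_eq0 -(fmap_id x) => s0; apply/(IP K idfun)/(point_generate_unit Is).
by exists s^-1; rewrite mulfV.
Qed.

Section Points.
Variables (V : zfunctor) (V_sep : separated V) (V_ft : finite_type V).
Variable k : comPzRingType.
Let X := base_change V k.

Definition over_point (K B : comPzRingType) (x : X K) (y : X B)
    (f : {rmorphism K -> B}) : Prop :=
  fmap V f x.1 = y.1 /\ forall c, f (x.2 c) = y.2 c.

Lemma image_pointP (K B : comPzRingType) (x : X K) (y : X B) :
  Defs.image_sub x y <-> exists f, over_point x y f.
Proof.
split=> [[f <-]|[f [f1 f2]]]; exists f; first by split.
by rewrite /= [RHS]surjective_pairing f1; congr pair; apply: rmorphism_ext.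
Qed.

Variables (K : finFieldType) (x : X K).

(** In every chart containing x, the coordinates of x and the constants generate K
    as a ring, so that Spec K embeds as a closed subscheme of the chart over k;
    this is what makes K the residue field of a closed point. *)
Definition generates_residue : Prop :=
  forall (A : comPzRingType) (u : V A) (h : {rmorphism A -> K}),
    is_mono u -> fmap V h u = x.1 ->
  forall E : set K, E 1 -> (forall a b, E a -> E b -> E (a - b)) ->
    (forall a b, E a -> E b -> E (a * b)) -> (forall c, E (x.2 c)) ->
    (forall a, E (h a)) -> forall z, E z.

Hypothesis x_gen : generates_residue.

(** Two morphisms that agree on coordinates and constants agree on a subring
    containing them. *)
Lemma generates_mono : is_mono x.
Proof.
move=> B f g fgx; have [A [u [[[umono _] _] [h hu]]]] := chart_of_point V_ft x.1.
have [fg1 fg2] : fmap V f x.1 = fmap V g x.1 /\ forall c, f (x.2 c) = g (x.2 c).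
  case: x fgx => x1 x2 [e1 e2]; split=> // c.
  exact: (congr1 (fun a => a c) e2).
apply: (x_gen umono hu (E := [set z | f z = g z])) => /=; first by rewrite !rmorph1.
- by move=> a b; rewrite !rmorphB => -> ->.
- by move=> a b; rewrite !rmorphM => -> ->.
- exact: fg2.
- by apply: (umono _ (f \o h) (g \o h)); rewrite !fmap_comp hu.
Qed.

(** Coordinates of x become functions of the coordinates of y, with values in L;
    since they generate K, the image of K is contained in L. *)
Lemma over_point_descends (L L' : fieldType) (g : {rmorphism L -> L'}) (y : X L) :
  (exists f, over_point x (fmap X g y) f) -> exists f, over_point x y f.
Proof.
move=> [f [/= f1 f2]].
have [A [u [[[umono uopen] _] [h hu]]]] := chart_of_point V_ft y.1.
have [h0 h0u] : Defs.image_sub u x.1.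
  apply: (open_sub_descends (f := f) uopen).
  by exists (g \o h); rewrite fmap_comp hu f1.
have fh0 : f \o h0 =1 g \o h by apply: umono; rewrite !fmap_comp hu h0u.
have fg (z : K) : exists w, g w = f z.
  apply: (x_gen umono h0u (E := [set z | exists w, g w = f z])) => /=.
  - by exists 1; rewrite !rmorph1.
  - by move=> a b [v ev] [w ew]; exists (v - w); rewrite !rmorphB ev ew.
  - by move=> a b [v ev] [w ew]; exists (v * w); rewrite !rmorphM ev ew.
  - by move=> c; exists (y.2 c); rewrite f2.
  - by move=> a; exists (h a); exact: esym (fh0 a).
have [f' f'E] := rmorphism_factor (fmorph_inj g) fg.
exists f'; split=> [|c]; last by apply: (fmorph_inj g); rewrite f'E f2.
apply: (separated_fmap_inj V_sep (fmorph_inj g)).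
by rewrite -fmap_comp -f1; apply: eq_fmap.
Qed.

(** The closed subset of Spec A lying over x is cut out by the functions vanishing
    on it.  At a zero g of this ideal, the point a of V has coordinates h in a
    localization of A; a function of these coordinates which takes at x the value
    z takes at g a value that depends on z only, because a function vanishing at
    x yields, after clearing denominators, an element of the ideal. *)
Lemma vanishing_ideal_zero (A : comPzRingType) (a : X A) (L : fieldType)
    (g : {rmorphism A -> L}) :
  (forall s, (forall (L' : fieldType) (g' : {rmorphism A -> L'}) f,
                over_point x (fmap X g' a) f -> g' s = 0) -> g s = 0) ->
  exists f, over_point x (fmap X g a) f.
Proof.
move=> gI; have [R [u [[[umono uopen] _] uga]]] := chart_of_point V_ft (fmap V g a.1).
have [J JP] := uopen A a.1.
have [s Js gs] : exists2 s, J s & g s != 0 by apply/generate_unit_point/JP.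
have [B [l [ls lden lext]]] := localization gs.
have [h hu] : Defs.image_sub u (fmap V l a.1) by apply/JP/(point_generate_unit Js).
have [g1 g1E] := lext L g gs.
have [h0 h0u] : Defs.image_sub u x.1.
  apply: contrapT => nux; move/eqP: gs; apply; apply: gI => L' g' f [f1 _].
  apply: contra_notP nux => /eqP g's.
  apply: (open_sub_descends (f := f) uopen); rewrite f1; apply/JP.
  by apply: (point_generate_unit Js); exists (g' s)^-1; rewrite mulfV.
(* The graph of the wanted morphism.  The value z of b at x is imposed at all the
   points of the localization over x simultaneously. *)
pose G z w := exists2 b, w = g1 b & forall (L' : fieldType) (g' : {rmorphism B -> L'}) f,
  over_point x (fmap X (g' \o l) a) f -> g' b = f z.
have G1 : G 1 1 by exists 1; rewrite ?rmorph1 // => *; rewrite !rmorph1.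
have GB z w z' w' : G z w -> G z' w' -> G (z - z') (w - w').
  move=> [b -> bP] [b' -> b'P]; exists (b - b'); rewrite ?rmorphB // => L' g' f xf.
  by rewrite !rmorphB (bP _ _ _ xf) (b'P _ _ _ xf).
have GM z w z' w' : G z w -> G z' w' -> G (z * z') (w * w').
  move=> [b -> bP] [b' -> b'P]; exists (b * b'); rewrite ?rmorphM // => L' g' f xf.
  by rewrite !rmorphM (bP _ _ _ xf) (b'P _ _ _ xf).
have Gk c : G (x.2 c) (g (a.2 c)).
  by exists (l (a.2 c)) => [|L' g' f [_ ->]]; rewrite ?g1E.
have Gh r : G (h0 r) (g1 (h r)).
  exists (h r) => // L' g' f [f1 _]; have := umono _ (g' \o h) (f \o h0).
  by apply; rewrite !fmap_comp hu h0u f1 -fmap_comp.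
have G0 w : G 0 w -> w = 0.
  move=> [b -> bP]; have [N [t tE]] := lden b.
  have : g (s * t) = 0.
    apply: gI => L' g' f xf; have [g's0|g's] := eqVneq (g' s) 0.
      by rewrite rmorphM g's0 mul0r.
    have [g'1 g'1E] := lext L' g' g's.
    rewrite rmorphM -(g'1E t) -tE rmorphM (bP L' g'1 f) ?rmorph0 ?mulr0 //.
    case: xf => f1 f2; split=> [|c] /=; last by rewrite f2 g'1E.
    by rewrite f1; apply: eq_fmap => r; rewrite /= g'1E.
  move/eqP; rewrite rmorphM mulf_eq0 (negPf gs) /= -g1E -tE rmorphM rmorphXn g1E.
  by rewrite mulf_eq0 expf_eq0 (negPf gs) andbF => /eqP.
have Gtot z : exists w, G z w.
  apply: (x_gen umono h0u (E := [set z | exists w, G z w])) => /=.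
  - by exists 1.
  - by move=> z1 z2 [w1 G1'] [w2 G2]; exists (w1 - w2); apply: GB.
  - by move=> z1 z2 [w1 G1'] [w2 G2]; exists (w1 * w2); apply: GM.
  - by move=> c; exists (g (a.2 c)).
  - by move=> r; exists (g1 (h r)).
have [f fG] := rmorphism_of_rel Gtot G0 G1 GB GM.
have Guniq z w w' : G z w -> G z w' -> w = w'.
  by move=> Gw Gw'; apply/subr0_eq/G0; rewrite -(subrr z); apply: GB.
exists f; split=> /= [|c]; last exact: Guniq (fG _) (Gk c).
transitivity (fmap V (g1 \o h) u); last first.
  by rewrite fmap_comp hu -fmap_comp; apply: eq_fmap.
by rewrite -h0u -fmap_comp; apply: eq_fmap => r; apply: Guniq (fG _) (Gh r).
Qed.

Lemma generates_closed (x_mono : is_mono x) :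
  closed_point (SchemePoint (residue := K) x_mono).
Proof.
(* Only field-valued points enter the definition of U, so that no ring has to be
   glued from localizations. *)
pose U : subfunctor X := fun B => [set y | forall (L : fieldType)
  (g : {rmorphism B -> L}), ~ exists f, over_point x (fmap X g y) f].
exists U => [A a|L y]; last first.
  split=> [Uy /image_pointP xy|nxy L' g xg].
    by apply: (Uy L idfun); rewrite fmap_id.
  by apply: nxy; apply/image_pointP; apply: over_point_descends xg.
exists [set s | forall (L : fieldType) (g : {rmorphism A -> L}) f,
  over_point x (fmap X g a) f -> g s = 0].
move=> B f; split=> [Uf|[n [b [s [sI bs]]]] L g [f' xf']]; last first.
  move/(congr1 g)/eqP: bs; rewrite rmorph_sum rmorph1 big1 ?(eq_sym 0) ?oner_eq0 //.
  move=> i _; have fs0 : g (f (s i)) = 0.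
    by apply: (sI i L (g \o f) f'); rewrite fmap_comp.
  by rewrite rmorphM fs0 mulr0.
apply: contrapT => nfI; set I := (I in generate_unit f I) in nfI.
have [] := @ideal_field_point B (gen_ideal (f @` I)).
- exact: is_ideal_gen.
- move=> [n [b [s [Is bs]]]]; apply: nfI.
  have /choice[s' s'P] i : exists z, I z /\ f z = s i by have [z] := Is i; exists z.
  exists n, b, s'; split=> [i|]; first by have [] := s'P i.
  by rewrite bs; apply: eq_bigr => i _; have [_ ->] := s'P i.
move=> L [g g0]; apply: (Uf L g); rewrite -fmap_comp.
apply: vanishing_ideal_zero => s Is; apply/g0/gen_ideal_sub.
by exists s.
Qed.

End Points.
(** * Closed points and Frobenius orbits *)

Lemma same_point_sym (X : zfunctor) (x y : scheme_point X) :
  same_point x y -> same_point y x.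
Proof.
move=> [f [fbij fxy]]; have [g fK gK] := fbij.
have [h hE] := @rmorphism_factor _ _ _ idfun f (bij_inj fbij)
  (fun b => ex_intro _ (g b) (gK b)).
have hf : h \o f =1 idfun by move=> a; apply: (bij_inj fbij); rewrite /= hE.
exists h; split; first by exists f => // a; exact: hf.
by rewrite -fxy -fmap_comp -[RHS]fmap_id; apply: eq_fmap.
Qed.

Lemma same_point_trans (X : zfunctor) (x y z : scheme_point X) :
  same_point x y -> same_point y z -> same_point x z.
Proof.
move=> [f [fbij fxy]] [g [gbij gyz]]; exists (g \o f); split; first exact: bij_comp.
by rewrite fmap_comp fxy.
Qed.

Lemma num_closed_points_unique (V : zfunctor) (k : fieldType) d N
    (s : 'I_N -> scheme_point (base_change V k)) :
  (forall i, closed_point_of_degree d (s i)) ->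
  (forall i j, same_point (s i) (s j) -> i = j) ->
  (forall y, closed_point_of_degree d y -> exists i, same_point (s i) y) ->
  num_closed_points V k d = N.
Proof.
move=> sd sI sall; apply: xget_unique; first by exists s.
move=> M [s' [s'd s'I s'all]].
have le_card m n (t : 'I_m -> scheme_point (base_change V k))
    (t' : 'I_n -> scheme_point (base_change V k)) :
    (forall i, closed_point_of_degree d (t i)) ->
    (forall i j, same_point (t i) (t j) -> i = j) ->
    (forall y, closed_point_of_degree d y -> exists i, same_point (t' i) y) ->
    (m <= n)%N.
  move=> td tI t'all; have /choice[f fP] i := t'all _ (td i).
  rewrite -(card_ord m) -(card_ord n); apply: (@leq_card _ _ f) => i i' ff.
  apply: tI; apply: same_point_trans (same_point_sym (fP i)) _.
  by rewrite ff.
by apply/eqP; rewrite eqn_leq !(le_card _ _ s s', le_card _ _ s' s).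
Qed.

(** Field extensions of finite degree over a finite field are finite fields. *)
Lemma scheme_point_of_degree_ind (V : zfunctor) (k : finFieldType) d
    (P : scheme_point (base_change V k) -> Prop) :
  (forall (K : finFieldType) (x : base_change V k K) (x_mono : is_mono x),
     #|K| = (#|k| ^ d)%N -> P (SchemePoint (residue := K) x_mono)) ->
  forall y, closed_point_of_degree d y -> P y.
Proof.
move=> PK [K x x_mono] [_ /= degK].
have [K' [eK cardK]] := finite_of_field_degree degK.
by move: x x_mono {degK}; rewrite eK => x x_mono; apply: PK.
Qed.

Definition period (T : Type) (f : T -> T) (x : T) (d : nat) : Prop :=
  [/\ (0 < d)%N, iter d f x = x & forall m, (0 < m)%N -> iter m f x = x -> (d <= m)%N].

Section Correspondence.
Variables (V : zfunctor) (V_sep : separated V) (V_ft : finite_type V).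
Variables (p r : nat) (p_prime : prime p) (F : nat -> finFieldType).
Let k := F 1.
Let q := #|k|.
Hypotheses (qE : q = (p ^ r)%N) (F_card : forall m, (0 < m)%N -> #|F m| = (q ^ m)%N).
Variables (L : closedFieldType) (inc : {rmorphism k -> L}).
Variables (Frob : {rmorphism L -> L}) (FrobE : forall y, Frob y = y ^+ q).
Let X := base_change V k.
Notation phi := (fmap V Frob).

Lemma q_gt1 : (1 < q)%N. Proof. exact: card_finField_gt1. Qed.

Lemma expq_gt1 m : (0 < m)%N -> (1 < q ^ m)%N.
Proof. by move=> m0; rewrite -(exp1n m) ltn_exp2r // q_gt1. Qed.

Lemma leq_expq m n : (q ^ m <= q ^ n)%N = (m <= n)%N.
Proof. exact: leq_exp2l q_gt1. Qed.

Lemma pchar_ext (R : comNzRingType) (j : {rmorphism k -> R}) : p \in [pchar R].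
Proof. exact: (rmorph_pchar j (card_finPcharP qE p_prime)). Qed.

Lemma frobenius_ext (R : comNzRingType) (j : {rmorphism k -> R}) :
  exists f : {rmorphism R -> R}, forall y, f y = y ^+ q.
Proof. by rewrite qE; exact: frobenius_pow (pchar_ext j). Qed.

Lemma phi_inj : injective phi.
Proof. exact: (separated_fmap_inj V_sep (fmorph_inj Frob)). Qed.

Lemma finite_subfield m : (0 < m)%N ->
  exists (e : {rmorphism F m -> L}) (iota : {rmorphism k -> F m}),
    forall c, e (iota c) = inc c.
Proof.
move=> m0; have pF : p \in [pchar F m].
  by apply: (@card_finPcharP _ _ (r * m)) => //; rewrite F_card // qE expnM.
have [f1 _] := prime_field_embedding pF.
have [f2 _] := prime_field_embedding (pchar_ext inc).
have [e _] := finField_embedding f1 f2.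
have incP c : exists z, e z = inc c.
  apply: finField_image; rewrite F_card // -(iter_frob FrobE).
  exact: iter_frob_inc.
have [iota iotaE] := rmorphism_factor (fmorph_inj e) incP.
by exists e, iota.
Qed.

Lemma iter_Frob_ext (K : finFieldType) (e : {rmorphism K -> L}) m z :
  #|K| = (q ^ m)%N -> iter m Frob (e z) = e z.
Proof. by move=> cardK; rewrite (iter_frob FrobE) -/q -cardK -rmorphXn expf_card. Qed.

Lemma phi_fixed (K : finFieldType) (e : {rmorphism K -> L}) m x : (#|K| = q ^ m)%N ->
  iter m phi x = x <-> exists y, fmap V e y = x.
Proof.
move=> cardK; split=> [|[y <-]].
  rewrite -fmap_iter; apply: (fixed_point_descends V_ft (fmorph_inj e)) => y.
  rewrite iter_rmorphismE (iter_frob FrobE) -/q -cardK; exact: finField_image.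
rewrite -fmap_iter -fmap_comp; apply: eq_fmap => z /=.
by rewrite iter_rmorphismE iter_Frob_ext.
Qed.

(** A geometric point of V together with inc is a point of the base change of V. *)
Definition lies_over (K : finFieldType) (y : X K) (x : V L) : Prop :=
  exists e, over_point y ((x, inc) : X L) e.

(** If Frob ^ m fixes x, the q ^ m-power map of K fixes y, hence is the identity
    because y is a monomorphism; then K has at most q ^ m elements. *)
Lemma lies_over_period (K : finFieldType) (y : X K) x d : (0 < d)%N ->
  #|K| = (q ^ d)%N -> is_mono y -> lies_over y x -> period phi x d.
Proof.
move=> d0 cardK y_mono [e [/= ey e2]]; split=> // [|m m0 phix].
  by apply/(phi_fixed e _ cardK); exists y.1.
have [f fE] := frobenius_ext y.2; pose fm := iter_rmorphism f m.
have fmE z : fm z = z ^+ (q ^ m) by rewrite iter_rmorphismE (iter_frob fE).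
have : fmap X fm y = fmap X idfun y.
  rewrite fmap_id /= [RHS]surjective_pairing; congr pair.
    apply: (separated_fmap_inj V_sep (fmorph_inj e)).
    rewrite -fmap_comp ey -[RHS]phix -fmap_iter -ey -fmap_comp; apply: eq_fmap => z.
    by rewrite /= fmE iter_rmorphismE (iter_frob FrobE) rmorphXn.
  apply: rmorphism_ext => c /=; rewrite iter_rmorphismE.
  exact: (iter_frob_inc _ fE).
move/y_mono => fm1; rewrite -leq_expq -cardK.
by apply: card_le_expf_id => [|z]; [exact: expq_gt1 | rewrite -fmE fm1].
Qed.

Lemma exists_lies_over (K : finFieldType) (y : X K) : exists x, lies_over y x.
Proof.
by have [e eE] := finField_embedding y.2 inc; exists (fmap V e y.1), e; split.
Qed.

(** A subring of K containing the constants has at least q ^ m elements for some m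
    such that Frob ^ m fixes it pointwise; if it contains the coordinates of y
    then Frob ^ m fixes x, so that d <= m. *)
Lemma period_generates (K : finFieldType) (y : X K) x d :
  #|K| = (q ^ d)%N -> lies_over y x -> period phi x d -> generates_residue y.
Proof.
move=> cardK [e [/= ey e2]] [_ _ minx] A u h _ hu E E1 EB EM Ek Eh z.
have [f fE] := frobenius_ext y.2.
have [m [m0 Em [b [bI Eb]]]] := finite_subextension fE E1 EB EM Ek.
have le_dm : (d <= m)%N.
  apply: minx => //; rewrite -fmap_iter -ey -hu -!fmap_comp; apply: eq_fmap => a /=.
  by rewrite -[in RHS](Em _ (Eh a)) iter_rmorphismE (iter_frob FrobE) (iter_frob fE) rmorphXn.
have /codomP[c ->] // : z \in codom (fun c : {ffun 'I_m -> k} => \sum_i y.2 (c i) * b i).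
by apply: inj_card_onto; rewrite // card_ffun card_ord -/q cardK leq_expq.
Qed.

Lemma period_closed_point x d : period phi x d ->
  exists (y : X (F d)) (y_mono : is_mono y),
    lies_over y x /\ closed_point_of_degree d (SchemePoint (residue := F d) y_mono).
Proof.
move=> xd; have [d0 phix _] := xd; have [e [iota eE]] := finite_subfield d0.
have [y0 ey0] := (phi_fixed e x (F_card d0)).1 phix.
pose y : X (F d) := (y0, iota).
have yx : lies_over y x by exists e; split.
have y_gen := period_generates (F_card d0) yx xd.
have y_mono := generates_mono V_ft y_gen; exists y, y_mono; split=> //.
have [f fE] := frobenius_ext iota; split; first exact: generates_closed.
exact: (finite_field_degree iota fE (F_card d0)).
Qed.

(** Residue fields are identified with the same subfield of L, and embeddings of one
    field differ by powers of the Frobenius. *)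
Lemma same_point_orbit (K K' : finFieldType) (y : X K) (y' : X K')
    (y_mono : is_mono y) (y'_mono : is_mono y') x x' d : (0 < d)%N ->
  #|K| = (q ^ d)%N -> #|K'| = (q ^ d)%N -> lies_over y x -> lies_over y' x' ->
  same_point (SchemePoint (residue := K) y_mono) (SchemePoint (residue := K') y'_mono)
  <-> exists i, x' = iter i phi x.
Proof.
move=> d0 cK cK' [e [/= ey e2]] [e' [/= ey' e2']].
split=> [[/= f [_ fyy']]|[i x'E]].
  have [i iP] := @embeddings_frob_conjugate _ _ inc _ FrobE _ d y.2 e (e' \o f) d0 cK e2
    (fun c => etrans (congr1 (fun t : X K' => e' (t.2 c)) fyy') (e2' c)).
  exists i; rewrite -ey' -[y'.1](congr1 (fun t : X K' => t.1) fyy') -fmap_iter -ey.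
  rewrite -!fmap_comp; apply: eq_fmap => z.
  exact: etrans (iP z) (esym (iter_rmorphismE _ _ _)).
pose e1 := iter_rmorphism Frob i \o e.
have e1E z : e1 z = iter i Frob (e z) by exact: iter_rmorphismE.
have imE (K1 K2 : finFieldType) (h1 : {rmorphism K1 -> L}) (h2 : {rmorphism K2 -> L}) :
    #|K1| = (q ^ d)%N -> #|K2| = (q ^ d)%N -> forall z, exists w, h2 w = h1 z.
  by move=> c1 c2 z; apply: finField_image; rewrite c2 -c1 -rmorphXn expf_card.
have [f fE] := rmorphism_factor (fmorph_inj e') (imE _ _ e1 e' cK cK').
have [g gE] := rmorphism_factor (fmorph_inj e1) (imE _ _ e' e1 cK' cK).
exists f; split.
  by exists g => z; [apply: (fmorph_inj e1) | apply: (fmorph_inj e')]; rewrite ?gE ?fE ?gE.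
rewrite /= [RHS]surjective_pairing; congr pair.
  apply: (separated_fmap_inj V_sep (fmorph_inj e')); rewrite ey' x'E -fmap_iter -ey.
  by rewrite -!fmap_comp; apply: eq_fmap.
apply: rmorphism_ext => c; apply: (fmorph_inj e'); rewrite e2'.
transitivity (e1 (y.2 c)); first exact: fE.
rewrite e1E e2; exact: iter_frob_inc.
Qed.

(** Each orbit representative x i descends to a closed point, which recovers the
    orbit as the set of geometric points over it. *)
Lemma num_closed_points_orbits d N (x : 'I_N -> V L) :
  (forall i, period phi (x i) d) ->
  (forall i j m, x j = iter m phi (x i) -> i = j) ->
  (forall z, period phi z d -> exists i m, z = iter m phi (x i)) -> 
  (0 < d)%N -> num_closed_points V k d = N.
Proof.
move=> xd xI xall d0.
have /choice[s sP] i : exists y : {y : X (F d) | is_mono y}, lies_over (sval y) (x i) /\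
    closed_point_of_degree d (SchemePoint (residue := F d) (svalP y)).
  by have [y [y_mono yP]] := period_closed_point (xd i); exists (exist _ y y_mono).
apply: (@num_closed_points_unique _ _ _ _
  (fun i => SchemePoint (residue := F d) (svalP (s i)))) => [i|i j|].
- exact: (sP i).2.
- have cF := F_card d0.
  by move/(same_point_orbit _ _ d0 cF cF (sP i).1 (sP j).1) => [m /xI].
apply: scheme_point_of_degree_ind => K y y_mono cardK.
have [z yz] := exists_lies_over y.
have [i [m zE]] := xall z (lies_over_period d0 cardK y_mono yz).
exists i; apply/(same_point_orbit _ _ d0 (F_card d0) cardK (sP i).1 yz).
by exists m.
Qed.

End Correspondence.
(** * Formal power series *)

Section Fps.
Variable R : comUnitRingType.
Implicit Types f g : fps R.

(** Congruence modulo t ^ (n + 1). *)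
Definition fps_eqmod n f g := forall i, (i <= n)%N -> fcoef f i = fcoef g i.

Lemma fcoefM f g n : fcoef (f * g) n = \sum_(i < n.+1) fcoef f i * fcoef g (n - i).
Proof. by []. Qed.

Lemma fcoefD f g n : fcoef (f + g) n = fcoef f n + fcoef g n. Proof. by []. Qed.
Lemma fcoefN f n : fcoef (- f) n = - fcoef f n. Proof. by []. Qed.
Lemma fcoef1 n : fcoef (1 : fps R) n = (n == 0%N)%:R. Proof. by []. Qed.
Lemma fcoef_sum (I : Type) (s : seq I) (P : pred I) (F : I -> fps R) n :
  fcoef (\sum_(i <- s | P i) F i) n = \sum_(i <- s | P i) fcoef (F i) n.
Proof. by elim/big_rec2: _ => // i x y _ <-. Qed.

Lemma fcoefMC c f n : fcoef (fpsC c * f) n = c * fcoef f n.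
Proof.
rewrite fcoefM big_ord_recl subn0 /= big1 ?addr0 // => i _.
by rewrite mul0r.
Qed.

Lemma fcoefXn k n : fcoef ('t ^+ k : fps R) n = (n == k)%:R.
Proof.
elim: k n => [|k IHk] n; first by rewrite expr0.
rewrite exprS fcoefM; case: n => [|n]; first by rewrite big_ord1 /= mul0r.
rewrite big_ord_recl /= mul0r add0r big_ord_recl /= mul1r subn1 IHk big1 ?addr0 //.
by move=> i _; rewrite mul0r.
Qed.

Lemma fpsC_nat m : fpsC (m%:R : R) = m%:R.
Proof.
elim: m => [|m IHm]; first by apply: fpsP; case.
rewrite mulrS [in RHS]mulrS -IHm; apply: fpsP => n; rewrite fcoefD fcoef1 /=.
by case: (n == 0%N); rewrite // addr0.
Qed.

Lemma fps_eqmod_refl n f : fps_eqmod n f f. Proof. by []. Qed.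

Lemma fps_eqmodM n f f' g g' :
  fps_eqmod n f f' -> fps_eqmod n g g' -> fps_eqmod n (f * g) (f' * g').
Proof.
move=> ff gg i le_in; rewrite !fcoefM; apply: eq_bigr => l _.
have le_li : (l <= i)%N by rewrite -ltnS.
by rewrite ff ?gg // ?(leq_trans le_li) // (leq_trans (leq_subr _ _)).
Qed.

Lemma fps_eqmodX n f g m : fps_eqmod n f g -> fps_eqmod n (f ^+ m) (g ^+ m).
Proof. by move=> fg; elim: m => // m IHm; rewrite !exprS; apply: fps_eqmodM. Qed.

Lemma fps_unitE f : (f \is a GRing.unit) = (fcoef f 0 \is a GRing.unit).
Proof. by []. Qed.

Lemma fps_unit1D d f : (0 < d)%N -> 1 + 't ^+ d * f \is a GRing.unit.
Proof.
move=> d0; rewrite fps_unitE fcoefD fcoef1 fcoefM big_ord1 fcoefXn.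
by rewrite (ltn_eqF d0) mul0r addr0 unitr1.
Qed.

Lemma fps_unit1BX d : (0 < d)%N -> 1 - 't ^+ d \is a @GRing.unit (fps R).
Proof. by move=> d0; rewrite -mulrN1 fps_unit1D. Qed.

Lemma fps_unit1DX d : (0 < d)%N -> 1 + 't ^+ d \is a @GRing.unit (fps R).
Proof. by move=> d0; rewrite -['t ^+ d]mulr1 fps_unit1D. Qed.

Lemma fps_eqmodV n f g : f \is a GRing.unit -> fps_eqmod n f g ->
  fps_eqmod n f^-1 g^-1.
Proof.
move=> Uf fg; have Ug : g \is a GRing.unit by rewrite fps_unitE -fg.
have e1 : f^-1 = f^-1 * (g * g^-1) by rewrite mulrV ?mulr1.
have e2 : g^-1 = f^-1 * (f * g^-1) by rewrite mulrA mulVr ?mul1r.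
rewrite e2 {1}e1; apply: fps_eqmodM => //; apply: fps_eqmodM => //.
by move=> i le_in; rewrite fg.
Qed.

Lemma fps_dilate2M f g : fps_dilate 2 (f * g) = fps_dilate 2 f * fps_dilate 2 g.
Proof.
apply: fpsP => n; rewrite [RHS]fcoefM /=.
have [odd_n|even_n] := boolP (odd n).
  rewrite dvdn2 odd_n /= big1 // => i _; rewrite !dvdn2.
  rewrite oddB ?odd_n; last by rewrite -ltnS ltn_ord.
  by case: (odd i); rewrite /= ?mul0r ?mulr0.
have {even_n} -> : n = (n./2 * 2)%N.
  by rewrite muln2 -[LHS]odd_double_half (negPf even_n).
set m := n./2; rewrite dvdn_mull // mulnK //.
pose G i := if (2 %| i)%N then fcoef f (i %/ 2) * fcoef g (m - i %/ 2) else 0.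
transitivity (\sum_(0 <= i < (m * 2).+1) G i).
  rewrite -(big_mkord xpredT (fun i => fcoef f i * fcoef g (m - i))).
  suff sumG (h : nat -> R) l : \sum_(0 <= i < l.+1) h i =
      \sum_(0 <= i < (l * 2).+1) if (2 %| i)%N then h (i %/ 2)%N else 0.
    exact: sumG.
  elim: l => [|l IHl]; first by rewrite !big_nat1.
  rewrite big_nat_recr //= IHl mulSn !addSn add0n [RHS]big_nat_recr //=.
  rewrite [in RHS]big_nat_recr //=.
  have -> : (2 %| (l * 2).+1)%N = false by rewrite dvdn2 /= oddM andbF.
  by rewrite addr0 -[(l * 2).+2]/(l.+1 * 2)%N dvdn_mull // mulnK.
rewrite big_mkord; apply: eq_bigr => i _; rewrite /G.
case: ifP => [/dvdnP[l ->]|_] /=; last by rewrite mul0r.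
by rewrite -mulnBl dvdn_mull // !mulnK.
Qed.

Lemma fps_dilate2_1BX d : fps_dilate 2 (1 - 't ^+ d : fps R) = 1 - 't ^+ (d * 2).
Proof.
apply: fpsP => n /=; rewrite !fcoefXn ?fcoef1.
have [/dvdnP[l ->]|nd2n] := boolP (2 %| n)%N.
  by rewrite mulnK // muln_eq0 orbF eqn_pmul2r.
have -> : (n == 0)%N = false by apply: contraNF nd2n => /eqP ->.
have -> : (n == d * 2)%N = false by apply: contraNF nd2n => /eqP ->; rewrite dvdn_mull.
by rewrite subrr.
Qed.

End Fps.
(** From C(M, j) C(j, l) = C(M, l) C(M - l, j - l) and the binomial theorem. *)
Lemma binomial_sum (R : comNzRingType) (x : R) M l :
  \sum_(j < M.+1) ('C(M, j) * 'C(j, l))%:R * x ^+ j =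
  'C(M, l)%:R * x ^+ l * (1 + x) ^+ (M - l).
Proof.
have [lt_Ml|le_lM] := ltnP M l.
  rewrite bin_small // !mul0r big1 // => j _.
  by rewrite ['C(j, l)]bin_small ?muln0 ?mul0r // (leq_ltn_trans _ lt_Ml) // -ltnS.
rewrite -(big_mkord xpredT (fun j => ('C(M, j) * 'C(j, l))%:R * x ^+ j)).
rewrite (big_cat_nat (n := l)) //=; last exact: leqW.
rewrite big_nat big1 ?add0r => [|j lt_jl]; last by rewrite ['C(j, l)]bin_small ?muln0 ?mul0r.
rewrite -{1}[l]add0n big_addn subSn // big_mkord exprDn mulr_sumr.
apply: eq_bigr => i _; have le_iMl : (i <= M - l)%N by rewrite -ltnS.
have -> : ('C(M, i + l) * 'C(i + l, l) = 'C(M, l) * 'C(M - l, i))%N.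
  have le_ilM : (i + l <= M)%N by rewrite addnC -leq_subRL.
  apply/eqP; rewrite -(eqn_pmul2r (fact_gt0 (M - l - i))) -(eqn_pmul2r (fact_gt0 i)).
  rewrite -(eqn_pmul2r (fact_gt0 l)); apply/eqP.
  have e1 := bin_fact le_iMl; have e2 := bin_fact le_lM.
  have e3 := bin_fact le_ilM; have e4 := bin_fact (leq_addl i l).
  rewrite addnK in e4; rewrite addnC subnDA in e3 *.
  transitivity M`!; first by rewrite -e3 [(l + i)%N]addnC -e4; ring.
  by rewrite -e2 -e1; ring.
rewrite expr1n mul1r exprD natrM -mulr_natl; ring.
Qed.

Section EulerProduct.
Variables (R : comUnitRingType) (M : nat -> nat).

Definition euler_partial n : fps R :=
  \prod_(1 <= d < n.+1) (1 - 't ^+ d)^-1 ^+ M d.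

(** Factors of index greater than n are congruent to 1 modulo t ^ (n + 1), so the
    coefficient of t ^ n can be read off a partial product. *)
Definition euler_product : fps R := Fps (fun n => fcoef (euler_partial n) n).

Lemma euler_product_eqmod K : fps_eqmod K euler_product (euler_partial K).
Proof.
move=> i le_iK; rewrite /= /euler_partial.
rewrite [in RHS](big_cat_nat (n := i.+1)) //=.
rewrite -[X in fcoef X i = _]mulr1; apply: (@fps_eqmodM _ i) => //.
rewrite big_nat; elim/big_ind: _ => // [f g f1 g1|d /andP[lt_id _]].
  by rewrite -[1]mulr1; apply: fps_eqmodM.
rewrite -[X in fps_eqmod _ X _](expr1n _ (M d)); apply: fps_eqmodX.
rewrite -[X in fps_eqmod _ X _]invr1; apply: fps_eqmodV => [|l le_li].
  exact: unitr1.
have -> : fcoef (1 - 't ^+ d : fps R) l = fcoef 1 l - (l == d)%:R.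
  by rewrite fcoefD fcoefN fcoefXn.
by rewrite (ltn_eqF (leq_ltn_trans le_li lt_id)) subr0.
Qed.

Lemma fps_dilate2_eqmod K (f g : fps R) :
  fps_eqmod K f g -> fps_eqmod K (fps_dilate 2 f) (fps_dilate 2 g).
Proof.
move=> fg i le_iK /=; case: ifP => // _; apply: fg.
exact: leq_trans (leq_div _ _) le_iK.
Qed.

Lemma fps_dilate2_1 : fps_dilate 2 (1 : fps R) = 1.
Proof.
apply: fpsP => n /=; case: ifP => [/dvdnP[l ->]|].
  by rewrite mulnK // muln_eq0 orbF.
by case: n.
Qed.

Lemma fps_dilate2_euler_partial K :
  fps_dilate 2 (euler_partial K) * \prod_(1 <= d < K.+1) (1 - 't ^+ (d * 2)) ^+ M d = 1.
Proof.
rewrite /euler_partial; elim: K => [|K IHK].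
  by rewrite !big_nil fps_dilate2_1 mulr1.
rewrite big_nat_recr // [X in _ * X]big_nat_recr // fps_dilate2M mulrACA IHK mul1r.
elim: (M _) => [|m IHm]; first by rewrite !expr0 fps_dilate2_1 mulr1.
rewrite 2![_ ^+ m.+1]exprS fps_dilate2M mulrACA IHm mulr1 -fps_dilate2_1BX -fps_dilate2M.
by rewrite mulVr ?fps_dilate2_1 // fps_unit1BX.
Qed.

(** Each factor is (1 - t ^ 2d) / (1 - t ^ d) = 1 + t ^ d. *)
Lemma euler_ratio_eqmod K :
  fps_eqmod K (euler_product / fps_dilate 2 euler_product)
    (\prod_(1 <= d < K.+1) (1 + 't ^+ d) ^+ M d).
Proof.
pose Q := \prod_(1 <= d < K.+1) (1 - 't ^+ (d * 2) : fps R) ^+ M d.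
have DQ := fps_dilate2_euler_partial K.
have UD : fps_dilate 2 (euler_partial K) \is a GRing.unit.
  by apply/unitrPr; exists Q.
have -> : \prod_(1 <= d < K.+1) (1 + 't ^+ d : fps R) ^+ M d =
    euler_partial K / fps_dilate 2 (euler_partial K).
  have -> : (fps_dilate 2 (euler_partial K))^-1 = Q.
    by apply: (mulrI UD); rewrite mulrV ?DQ.
  rewrite /euler_partial -big_split !big_nat /=; apply: eq_bigr => d /andP[d0 _].
  rewrite -exprMn; congr (_ ^+ _); apply: (mulrI (fps_unit1BX R d0)).
  rewrite mulrA mulrV ?fps_unit1BX // mul1r exprM; ring.
apply: fps_eqmodM; first exact: euler_product_eqmod.
apply: fps_eqmodV; last exact: fps_dilate2_eqmod (@euler_product_eqmod K).
rewrite fps_unitE /= /euler_partial big_nil fcoef1; exact: unitr1.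
Qed.

Lemma euler_binomial_eqmod K (la : nat -> nat) l : (l <= K)%N ->
    (forall k, (l < k)%N -> la k = 0%N) ->
  fps_eqmod K
    (euler_product / fps_dilate 2 euler_product * \prod_(1 <= k < l.+1)
      (fpsC 'C(M k, la k)%:R * ('t ^+ k / (1 + 't ^+ k)) ^+ la k))
    (\prod_(1 <= k < K.+1)
       \sum_(j < (M k).+1) ('C(M k, j) * 'C(j, la k))%:R * ('t ^+ k) ^+ j).
Proof.
move=> le_lK la0.
have -> : \prod_(1 <= k < l.+1) (fpsC 'C(M k, la k)%:R * ('t ^+ k / (1 + 't ^+ k)) ^+ la k) =
  \prod_(1 <= k < K.+1) (fpsC 'C(M k, la k)%:R * ('t ^+ k / (1 + 't ^+ k)) ^+ la k) :> fps R.
  rewrite [RHS](big_cat_nat (n := l.+1)) //= [X in _ * X]big_nat [X in _ * X]big1 ?mulr1 //.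
  by move=> k /andP[lt_lk _]; rewrite la0 // bin0 expr0 fpsC_nat mulr1.
have -> : \prod_(1 <= k < K.+1)
       \sum_(j < (M k).+1) ('C(M k, j) * 'C(j, la k))%:R * ('t ^+ k) ^+ j =
  (\prod_(1 <= d < K.+1) (1 + 't ^+ d) ^+ M d) *
  \prod_(1 <= k < K.+1) (fpsC 'C(M k, la k)%:R * ('t ^+ k / (1 + 't ^+ k)) ^+ la k) :> fps R.
  rewrite -big_split !big_nat /=; apply: eq_bigr => k /andP[k0 _].
  rewrite binomial_sum fpsC_nat; have [lt_M|le_M] := ltnP (M k) (la k).
    by rewrite bin_small // !mul0r mulr0.
  rewrite exprMn exprVn; set y := 1 + 't ^+ k; set c := _%:R; set x := _ ^+ la k.
  have Uy : y ^+ la k \is a GRing.unit by rewrite unitrX // fps_unit1DX.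
  have -> : y ^+ M k = y ^+ (M k - la k) * y ^+ la k by rewrite -exprD subnK.
  by rewrite -[LHS]mulr1 -(mulrV Uy); ring.
exact: fps_eqmodM (@euler_ratio_eqmod K) (@fps_eqmod_refl _ _ _).
Qed.

End EulerProduct.
(** * Stable subsets of a permutation *)

Lemma sum_subsets_card (R : comNzRingType) (T : finType) (A : {set T}) (g : nat -> R) :
  \sum_(S : {set T} | S \subset A) g #|S| =
  \sum_(j < #|A|.+1) 'C(#|A|, j)%:R * g j.
Proof.
rewrite (partition_big (fun S : {set T} => inord #|S| : 'I_(#|A|.+1)) xpredT) //=.
apply: eq_bigr => j _; rewrite -cards_draws mulr_natl -sumr_const.
apply: eq_big => [S|S /andP[sSA /eqP <-]].
  rewrite inE; have [sSA|//] := boolP (S \subset A); rewrite andTb andTb.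
  by rewrite -val_eqE /= inordK // ltnS subset_leq_card.
by rewrite inordK // ltnS subset_leq_card.
Qed.

(** Subsets of a graded set are chosen degree by degree. *)
Lemma sum_subsets_graded (R : comNzRingType) (T : finType) (O : {set T})
    (s : T -> nat) K (f : nat -> nat -> R) :
  (forall c, c \in O -> (0 < s c <= K)%N) ->
  \sum_(S : {set T} | S \subset O)
    \prod_(1 <= k < K.+1) f k #|[set c in S | s c == k]%SET| =
  \prod_(1 <= k < K.+1) \sum_(j < #|[set c in O | s c == k]%SET|.+1)
    'C(#|[set c in O | s c == k]%SET|, j)%:R * f k j.
Proof.
move=> sO; pose Ok (k : nat) := [set c in O | s c == k]%SET.
under [RHS]eq_bigr => k _ do rewrite -/(Ok k) -sum_subsets_card.
rewrite big_add1 big_mkord /= bigA_distr_big_dep /=.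
rewrite (reindex_onto (fun S : {set T} => [ffun i : 'I_K => S :&: Ok i.+1]%SET)
  (fun h : {ffun 'I_K -> {set T}} => \bigcup_i h i)%SET) /=; last first.
  move=> h /familyP hfam; have hO i : h i \subset Ok i.+1 := hfam i.
  apply/ffunP => i; rewrite ffunE; apply/setP => c.
  have hs l : c \in h l -> s c = l.+1.
    by move/(fintype.subsetP (hO l)); rewrite inE => /andP[_ /eqP].
  rewrite inE; apply/andP/idP => [[/bigcupP[l _ cl]]|ci].
    by rewrite inE (hs _ cl) => /andP[_ /eqP[/ord_inj <-]].
  by split; [apply/bigcupP; exists i | exact: (fintype.subsetP (hO i))].
apply: eq_big => [S|S sSO].
  apply/idP/andP => [sSO|[_ /eqP <-]].
    split; first by apply/familyP => i; rewrite ffunE; exact: subsetIr.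
    apply/eqP/setP => c; apply/bigcupP/idP => [[i _]|cS]; first by rewrite ffunE inE => /andP[].
    have /andP[s0 sK] := sO c (fintype.subsetP sSO c cS).
    have lt_sK : ((s c).-1 < K)%N by rewrite prednK.
    by exists (Ordinal lt_sK); rewrite // ffunE !inE cS (fintype.subsetP sSO) //= prednK.
  apply/bigcupsP => i _; rewrite ffunE; apply: fintype.subset_trans (subsetIr _ _) _.
  by apply/fintype.subsetP => c; rewrite inE => /andP[].
rewrite big_add1 big_mkord /=; apply: eq_bigr => i _.
rewrite ffunE; congr (f _ #|pred_of_set _|).
by apply/setP => c; rewrite !inE; have [/(fintype.subsetP sSO) -> //|//] := boolP (c \in S).
Qed.

Lemma sum_by_value (T : finType) (P : pred T) (s : T -> nat) (r : seq nat) :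
  uniq r -> (forall c, P c -> s c \in r) ->
  (\sum_(c | P c) s c = \sum_(k <- r) k * #|[set c | P c & s c == k]%SET|)%N.
Proof.
move=> Ur Pr; transitivity (\sum_(c | P c) \sum_(k <- r | s c == k) k)%N.
  apply: eq_bigr => c Pc; rewrite big_mkcond (bigD1_seq (s c)) ?Pr //= eqxx big1 ?addn0 // => k.
  by rewrite eq_sym => /negPf ->.
rewrite (exchange_big_dep xpredT) //=; apply: eq_bigr => k _.
by rewrite sum_nat_const mulnC; congr (_ * _)%N; apply: eq_card => c; rewrite !inE.
Qed.

Section Stable.
Variables (N : nat) (s : 'S_N).

Definition perm_stable (C : {set 'I_N}) := [forall (i | i \in C), s i \in C].

Definition orbits_in (C : {set 'I_N}) k :=
  #|[set c in porbits s | (c \subset C) && (#|c| == k)]%SET|.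

Lemma stable_iter C i m : perm_stable C -> i \in C -> iter m s i \in C.
Proof. by move=> /forall_inP sC iC; elim: m => //= m /sC. Qed.

Lemma stable_porbit C i : perm_stable C -> (porbit s i \subset C) = (i \in C).
Proof.
move=> sC; apply/fintype.subsetP/idP => [->|iC j /porbitP[m ->]]; rewrite ?porbit_id //.
by rewrite permX stable_iter.
Qed.

Lemma card_stable C : perm_stable C -> #|C| = (\sum_(c in porbits s | c \subset C) #|c|)%N.
Proof.
move=> sC; rewrite -sum1_card.
rewrite (partition_big (porbit s) (fun c => (c \in porbits s) && (c \subset C))) /=.
  apply: eq_bigr => _ /andP[/imsetP[i _ ->] sub_iC]; rewrite -sum1_card.
  apply: eq_bigl => j; rewrite eq_porbit_mem andb_idl // => ji.
  exact: fintype.subsetP sub_iC j ji.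
by move=> i iC; rewrite imset_f // stable_porbit.
Qed.

Lemma stable_cover (S : {set {set 'I_N}}) : S \subset porbits s -> perm_stable (finset.cover S).
Proof.
move=> sS; apply/forall_inP => i /bigcupP[c cS ic]; apply/bigcupP; exists c => //.
have /imsetP[j _ e] := fintype.subsetP sS c cS; rewrite e in ic *.
have e1 := porbit_perm s 1 i; rewrite expg1 in e1.
by rewrite -eq_porbit_mem e1 eq_porbit_mem.
Qed.

Lemma porbits_in_cover (S : {set {set 'I_N}}) : S \subset porbits s ->
  [set c in porbits s | c \subset finset.cover S]%SET = S.
Proof.
move=> sS; apply/setP => c; rewrite inE; apply/andP/idP => [[/imsetP[i _ ->]]|cS].
  rewrite stable_porbit ?stable_cover // => /bigcupP[d dS id].
  have /imsetP[j _ e] := fintype.subsetP sS d dS.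
  by rewrite e -eq_porbit_mem in id; rewrite (eqP id) -e.
by split; [exact: fintype.subsetP cS | exact: finset.bigcup_sup].
Qed.

Lemma cover_porbits_in C : perm_stable C ->
  finset.cover [set c in porbits s | c \subset C]%SET = C.
Proof.
move=> sC; apply/setP => i; apply/bigcupP/idP => [[c]|iC].
  by rewrite inE => /andP[_ /fintype.subsetP cC] /cC.
by exists (porbit s i); rewrite ?porbit_id // inE imset_f // stable_porbit.
Qed.

(** A stable subset is a set of cycles, so the sum over stable subsets splits as a
    product over the lengths of cycles. *)
Lemma sum_stable_binomial (R : comNzRingType) (t : R) (la : nat -> nat) K :
  (forall c, c \in porbits s -> (#|c| <= K)%N) ->
  \sum_(C : {set 'I_N} | perm_stable C)
    (\prod_(1 <= k < K.+1) 'C(orbits_in C k, la k))%:R * t ^+ #|C| =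
  \prod_(1 <= k < K.+1) \sum_(j < (orbits_in [set: 'I_N] k).+1)
    ('C(orbits_in [set: 'I_N] k, j) * 'C(j, la k))%:R * (t ^+ k) ^+ j.
Proof.
move=> leK; have gt0 c : c \in porbits s -> (0 < #|c|)%N.
  by move=> /imsetP[i _ ->]; rewrite lt0n card_porbit_neq0.
pose Ok (S : {set {set 'I_N}}) k := #|[set c in S | #|c| == k]%SET|.
have OkE C k : orbits_in C k = Ok [set c in porbits s | c \subset C]%SET k.
  by apply: eq_card => c; rewrite !inE andbA.
have OkT k : orbits_in [set: 'I_N] k = Ok (porbits s) k.
  by apply: eq_card => c; rewrite !inE finset.subsetT.
transitivity (\sum_(S : {set {set 'I_N}} | S \subset porbits s)
    \prod_(1 <= k < K.+1) ('C(Ok S k, la k)%:R * (t ^+ k) ^+ Ok S k)); last first.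
  rewrite (@sum_subsets_graded _ _ _ (fun c : {set 'I_N} => #|c|) K
    (fun k j => 'C(j, la k)%:R * (t ^+ k) ^+ j)).
    apply: eq_bigr => k _; rewrite OkT; apply: eq_bigr => j _.
    by rewrite natrM mulrA.
  by move=> c cs; rewrite gt0 ?leK.
rewrite (reindex_onto (fun S : {set {set 'I_N}} => finset.cover S)
  (fun C => [set c in porbits s | c \subset C]%SET)) /=; last first.
  by move=> C; exact: cover_porbits_in.
apply: eq_big => [S|S /andP[sS /eqP eS]].
  apply/andP/idP => [[_ /eqP <-]|sS]; last by rewrite stable_cover ?porbits_in_cover.
  by apply/fintype.subsetP => c; rewrite inE => /andP[].
rewrite natr_prod big_split /=; congr (_ * _).
  by apply: eq_bigr => k _; rewrite OkE eS.
rewrite card_stable //.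
have -> : (\sum_(c in porbits s | c \subset finset.cover S) #|c| = \sum_(c in S) #|c|)%N.
  by apply: eq_bigl => c; rewrite -{2}eS inE.
rewrite (@sum_by_value _ (mem S) _ (index_iota 1 K.+1)) ?iota_uniq //; last first.
  move=> c; rewrite inE -eS inE => /andP[cs _].
  by rewrite mem_index_iota ltnS gt0 ?leK.
by rewrite expr_sum; apply: eq_bigr => k _; rewrite exprM.
Qed.

Lemma iter_fixed_porbit m i : (iter m s i == i) = (#|porbit s i| %| m)%N.
Proof.
set d := #|porbit s i|; have d0 : (0 < d)%N by rewrite lt0n card_porbit_neq0.
have iterM l : iter (l * d) s i = i.
  by elim: l => // l IHl; rewrite mulSn iterD IHl iter_porbit.
have -> : iter m s i = iter (m %% d) s i by rewrite {1}(divn_eq m d) addnC iterD iterM.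
rewrite /dvdn; apply/eqP/eqP => [e|-> //].
have lt_md := ltn_pmod m d0; have := uniq_traject_porbit s i.
move/uniqP => /(_ i (m %% d)%N 0%N).
by rewrite !inE size_traject !nth_traject //; apply.
Qed.

Lemma card_iter_fixed m : (0 < m)%N ->
  #|[set i | iter m s i == i]%SET| = (\sum_(d <- divisors m) d * orbits_in [set: 'I_N] d)%N.
Proof.
move=> m0; set C := [set i | _]%SET.
have sC : perm_stable C.
  by apply/forall_inP => i; rewrite !inE -iterSr => /eqP /= ->.
rewrite card_stable // (@sum_by_value _ _ _ (divisors m)) ?divisors_uniq //.
  rewrite !big_seq; apply: eq_bigr => d; rewrite -dvdn_divisors // => dm.
  congr (_ * _)%N; apply: eq_card => c; rewrite !inE finset.subsetT -andbA.
  apply: andb_id2l => /imsetP[i _ ->]; rewrite stable_porbit //= inE iter_fixed_porbit.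
  by rewrite andb_idl // => /eqP ->.
move=> _ /andP[/imsetP[i _ ->]]; rewrite stable_porbit // inE iter_fixed_porbit.
by rewrite dvdn_divisors.
Qed.

End Stable.
(** * Moebius inversion *)

Lemma moebius_mul_prime p e : prime p -> (0 < e)%N ->
  moebius (p * e) = if (p %| e)%N then 0 else - moebius e.
Proof.
move=> p_pr e0; have p0 := prime_gt0 p_pr; rewrite /moebius.
have primesE : primes (p * e) =i p :: primes e.
  by move=> l; rewrite primesM // primes_prime // !inE.
have logE l : prime l -> logn l (p * e) = ((l == p) + logn l e)%N.
  by move=> l_pr; rewrite lognM // logn_prime.
rewrite (eq_all_r primesE) /= logE // eqxx add1n eqSS.
have [pe|npe] := boolP (p %| e)%N.
  have : (0 < logn p e)%N by rewrite logn_gt0 mem_primes p_pr e0.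
  by case: (logn p e).
have pNe : p \notin primes e by rewrite mem_primes (negPf npe) !andbF.
have -> : logn p e = 0%N by apply/eqP; rewrite -leqn0 leqNgt logn_gt0.
have -> : all (fun l => logn l (p * e) == 1%N) (primes e) =
          all (fun l => logn l e == 1%N) (primes e).
  apply: eq_in_all => l le; rewrite logE; last by move: le; rewrite mem_primes => /andP[].
  by have [lp|//] := eqVneq l p; rewrite -lp le in pNe.
have sz : size (primes (p * e)) = (size (primes e)).+1.
  apply: (@perm_size _ (primes (p * e)) (p :: primes e)).
  by apply: uniq_perm; rewrite ?primes_uniq //= pNe primes_uniq.
by rewrite sz exprS mulN1r /=; case: ifP; rewrite ?oppr0.
Qed.

(** For a prime p dividing n, the divisors d prime to p cancel against the p * d; the
    other divisors contribute 0. *)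
Lemma sum_moebius n : (0 < n)%N -> \sum_(d <- divisors n) moebius d = (n == 1%N)%:R.
Proof.
move=> n0; have [->|n1] := eqVneq n 1%N; first by rewrite big_seq1.
have p_pr : prime (pdiv n) by rewrite pdiv_prime // ltn_neqAle eq_sym n1.
set p := pdiv n in p_pr; have p0 := prime_gt0 p_pr.
have /dvdnP[m nE] : (p %| n)%N := pdiv_dvd n.
have m0 : (0 < m)%N by move: n0; rewrite nE muln_gt0 => /andP[].
rewrite (bigID (fun d => p %| d)%N) /= -big_filter -[X in _ + X]big_filter.
rewrite (perm_big (map (muln p) (divisors m))); last first.
  apply: uniq_perm => [||d].
  - by rewrite filter_uniq // divisors_uniq.
  - rewrite map_inj_uniq ?divisors_uniq // => a b /eqP.
    by rewrite eqn_pmul2l // => /eqP.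
  rewrite mem_filter -dvdn_divisors //; apply/andP/mapP => [[/dvdnP[c ->] cn]|[c]].
    by exists c; rewrite 1?mulnC // -dvdn_divisors // -(@dvdn_pmul2r p) // -nE.
  by rewrite -dvdn_divisors // => cm ->; rewrite dvdn_mulr // nE mulnC dvdn_pmul2r.
rewrite [X in _ + X](perm_big [seq d <- divisors m | ~~ (p %| d)%N]); last first.
  apply: uniq_perm => [||d]; rewrite ?filter_uniq ?divisors_uniq //.
  rewrite !mem_filter -!dvdn_divisors //; apply: andb_id2l => npd.
  by rewrite nE Gauss_dvdl // coprime_sym prime_coprime.
rewrite big_map big_filter [X in _ + X]big_mkcond -big_split /= big_seq big1 // => d.
rewrite -dvdn_divisors // => dm; rewrite moebius_mul_prime ?(dvdn_gt0 m0) //.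
by case: ifP => _; rewrite ?addr0 // addNr.
Qed.

Lemma moebius_inversion (M Nm : nat -> nat) k : (0 < k)%N ->
  (forall m, (m %| k)%N -> Nm m = \sum_(d <- divisors m) d * M d)%N ->
  \sum_(m <- divisors k) (moebius (k %/ m))%:~R * (Nm m)%:R = (k * M k)%:R :> rat.
Proof.
move=> k0 NmE.
transitivity (\sum_(m <- divisors k) \sum_(d <- divisors k | (d %| m)%N)
    (moebius (k %/ m))%:~R * (d * M d)%:R : rat).
  rewrite big_seq [RHS]big_seq; apply: eq_bigr => m; rewrite -dvdn_divisors // => mk.
  rewrite -mulr_sumr NmE // natr_sum; congr (_ * _).
  rewrite -[RHS]big_filter; apply: perm_big; apply: uniq_perm => [||d].
  - exact: divisors_uniq.
  - by rewrite filter_uniq // divisors_uniq.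
  rewrite mem_filter -!dvdn_divisors ?(dvdn_gt0 k0) //.
  by rewrite andb_idr // => /dvdn_trans; apply.
rewrite (exchange_big_dep xpredT) //=.
rewrite (bigD1_seq k) ?divisors_uniq ?divisors_id //=.
have inner d : (d %| k)%N -> \sum_(m <- divisors k | (d %| m)%N)
    (moebius (k %/ m))%:~R * (d * M d)%:R = ((k %/ d == 1)%N)%:R * (d * M d)%:R :> rat.
  move=> dk; have d0 := dvdn_gt0 k0 dk; rewrite -mulr_suml; congr (_ * _).
  have kd0 : (0 < k %/ d)%N by rewrite divn_gt0 // dvdn_leq.
  transitivity ((\sum_(e <- divisors (k %/ d)) moebius e)%:~R : rat); last first.
    by rewrite sum_moebius //; case: (k %/ d == 1)%N.
  rewrite rmorph_sum /=.
  rewrite -big_filter -(big_map (fun m => k %/ m)%N xpredT (fun e => (moebius e)%:~R)) /=.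
  apply: perm_big; apply: uniq_perm => [||e].
  - rewrite map_inj_in_uniq ?filter_uniq ?divisors_uniq // => a b.
    rewrite !mem_filter -!dvdn_divisors // => /andP[_ ak] /andP[_ bk] e.
    have kb0 : (0 < k %/ b)%N by rewrite divn_gt0 ?(dvdn_gt0 k0 bk) // dvdn_leq.
    by apply/eqP; rewrite -(eqn_pmul2l kb0) -{1}e !divnK.
  - exact: divisors_uniq.
  rewrite -dvdn_divisors //; apply/mapP/idP => [[m]|ekd].
    rewrite mem_filter -dvdn_divisors // => /andP[/dvdnP[c mE] mk] ->.
    have [f kE] := dvdnP mk; have m0 := dvdn_gt0 k0 mk.
    by rewrite {1}kE mulnK // kE mE mulnA mulnK // dvdn_mulr.
  have [f kdE] := dvdnP ekd; have kE : k = (f * d * e)%N.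
    by rewrite -(divnK dk) kdE mulnAC.
  have fd0 : (0 < f * d)%N by move: k0; rewrite kE muln_gt0 => /andP[].
  exists (f * d)%N; last by rewrite kE mulKn.
  by rewrite mem_filter -dvdn_divisors // dvdn_mull //= kE dvdn_mulr.
rewrite inner // divnn k0 eqxx mul1r big_seq_cond big1 ?addr0 // => d.
rewrite -dvdn_divisors // => /andP[dk ndk]; rewrite inner //.
have -> : (k %/ d == 1)%N = false; last by rewrite mul0r.
by apply: contraNF ndk => /eqP kd1; rewrite -(divnK dk) kd1 mul1n.
Qed.

Lemma necklaceE (V : zfunctor) (F : nat -> finFieldType) (M : nat -> nat) k :
  (0 < k)%N ->
  (forall m, (m %| k)%N -> natcard [set: V (F m)] = \sum_(d <- divisors m) d * M d)%N ->
  necklace V F k = (M k)%:R.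
Proof.
move=> k0 /(moebius_inversion k0); rewrite /necklace => ->.
by rewrite natrM mulKf // Num.Theory.pnatr_eq0 -lt0n.
Qed.

Lemma binom_nat M j : binom M%:R j = 'C(M, j)%:R.
Proof.
rewrite /binom -[RHS](@mulfK _ j`!%:R); last by rewrite Num.Theory.pnatr_eq0 -lt0n fact_gt0.
congr (_ / _); rewrite -natrM bin_ffact; elim: j => [|j IHj].
  by rewrite big_ord0 ffactn0.
rewrite big_ord_recr /= IHj ffactnSr natrM.
have [le_jM|lt_Mj] := leqP j M; first by rewrite natrB.
by rewrite ffact_small // !mul0r.
Qed.
(** * Enumeration of the points of small period *)

Lemma card_eq_enumP (T : Type) (A : set T) n :
  (A #= `I_n)%card <-> exists2 e : 'I_n -> T, injective e & range e = A.
Proof.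
split=> [/card_set_bijP[f [fI finj fsurj]]|[e eI <-]].
  have /choice[e eP] (i : 'I_n) : exists x, A x /\ f x = i.
    by have [x Ax fx] := fsurj i (ltn_ord i); exists x.
  exists e => [i j eij|]; first by apply: ord_inj; rewrite -(eP i).2 -(eP j).2 eij.
  apply/seteqP; split=> [_ [i _ <-]|x Ax]; first by have [] := eP i.
  exists (Ordinal (fI x Ax)) => //.
  by apply: finj; rewrite ?inE; [have [] := eP (Ordinal (fI x Ax))| |rewrite (eP _).2].
apply: card_eq_trans (_ : [set: 'I_n] #= `I_n)%card; last by rewrite card_eq_sym card_II.
by apply: inj_card_eq => i j _ _; apply: eI.
Qed.

Lemma natcardE (T : Type) (A : set T) n (e : 'I_n -> T) :
  injective e -> range e = A -> natcard A = n.
Proof.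
move=> eI eA; have An : (A #= `I_n)%card by apply/card_eq_enumP; exists e.
apply: xget_unique => // m Am; apply/card_eq_II.
by apply: card_eq_trans An; rewrite card_eq_sym.
Qed.

Section Enumeration.
Variables (T : Type) (phi : T -> T) (phi_inj : injective phi).
Variables (N : nat) (eps : 'I_N -> T) (s : 'S_N).
Hypotheses (eps_inj : injective eps) (eps_phi : forall i, phi (eps i) = eps (s i)).

Lemma iter_eps m i : iter m phi (eps i) = eps (iter m s i).
Proof. by elim: m => //= m ->. Qed.

Lemma period_eps i d : period phi (eps i) d <-> #|porbit s i| = d.
Proof.
have iterP m : iter m phi (eps i) = eps i <-> (#|porbit s i| %| m)%N.
  by rewrite iter_eps -iter_fixed_porbit; split=> [/eps_inj ->|/eqP ->].
have c0 : (0 < #|porbit s i|)%N by rewrite lt0n card_porbit_neq0.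
split=> [[d0 /iterP cd mind]|<-].
  by apply/eqP; rewrite eqn_leq (dvdn_leq d0 cd) mind //; apply/iterP.
by split=> // [|m m0 /iterP]; [apply/iterP | exact: dvdn_leq].
Qed.

Definition pull (C : set T) : {set 'I_N} := [set i | `[< C (eps i) >]]%SET.

Lemma mem_pull C i : (i \in pull C) <-> C (eps i).
Proof. by rewrite inE; split=> [/asboolP|/asboolP]. Qed.

Lemma pullK (C : {set 'I_N}) : pull (eps @` [set` C]) = C.
Proof.
apply/setP => i; apply/idP/idP => [/mem_pull[j /= jC /eps_inj <-] //|iC].
by apply/mem_pull; exists i.
Qed.

Lemma stable_image (C : {set 'I_N}) :
  phi @` (eps @` [set` C]) = eps @` [set` C] <-> perm_stable s C.
Proof.
split=> [phiC|sC].
  apply/forall_inP => i iC; rewrite -(pullK C); apply/mem_pull; rewrite -eps_phi -phiC.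
  by exists (eps i) => //; exists i.
apply/seteqP; split=> [_ [_ [i /= iC <-] <-]|_ [i /= iC <-]].
  by exists (s i); rewrite ?eps_phi //=; apply: (forall_inP sC).
exists (eps (iter #|porbit s i|.-1 s i)).
  by exists (iter #|porbit s i|.-1 s i) => //=; apply: stable_iter.
rewrite eps_phi -[s _]/(iter #|porbit s i|.-1.+1 s i) prednK ?iter_porbit //.
by rewrite lt0n card_porbit_neq0.
Qed.

Lemma card_image (C : {set 'I_N}) : (eps @` [set` C] #= `I_#|C|)%card.
Proof.
apply/card_eq_enumP; exists (eps \o @enum_val _ (mem C)).
  by move=> i j /eps_inj/enum_val_inj.
apply/seteqP; split=> [_ [i _ <-]|_ [i /= iC <-]].
  by exists (enum_val i) => //=; apply: enum_valP.
by exists (enum_rank_in iC i) => //=; rewrite enum_rankK_in.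
Qed.

Lemma conf_image (C : {set 'I_N}) n :
  conf phi n (eps @` [set` C]) <-> perm_stable s C && (#|C| == n).
Proof.
split=> [[Cn /stable_image ->]|/andP[/stable_image sC /eqP <-]]; last first.
  by split; [exact: card_image | exact: sC].
rewrite /=; apply/eqP/card_eq_II; apply: card_eq_trans Cn.
by rewrite card_eq_sym card_image.
Qed.

Lemma frob_perm_exists n (C : set T) : conf phi n C -> frob_acts_as phi C (frob_perm phi n C).
Proof.
move=> [/card_eq_enumP[e eI eC] phiC]; apply: xgetPex.
have /choice[f fE] i : exists j, phi (e i) = e j.
  have : C (phi (e i)) by rewrite -phiC; exists (e i) => //; rewrite -eC; exists i.
  by rewrite -eC => -[j _ <-]; exists j.
have fI : injective f by move=> i j fij; apply/eI/phi_inj; rewrite !fE fij.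
by exists (perm fI), e; split=> // i; rewrite permE fE.
Qed.

(** A permutation giving the action of the Frobenius on C has the cycle type of
    the restriction to C of the permutation of all points. *)
Lemma num_cycles_orbits_in n (C : {set 'I_N}) (u : 'S_n) k :
  frob_acts_as phi (eps @` [set` C]) u -> num_cycles k u = orbits_in s C k.
Proof.
move=> [e [eI eC eu]].
have /choice[f fP] i : exists j, j \in C /\ eps j = e i.
  have : (eps @` [set` C]) (e i) by rewrite -eC; exists i.
  by move=> [j jC <-]; exists j.
have fC i := (fP i).1; have fE i := (fP i).2.
have fI : injective f by move=> i j fij; apply: eI; rewrite -!fE fij.
have fonto j : j \in C -> exists i, f i = j.
  move=> jC; have : range e (eps j) by rewrite eC; exists j.
  by move=> [i _ ei]; exists i; apply: eps_inj; rewrite fE.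
have fs i : s (f i) = f (u i) by apply: eps_inj; rewrite -eps_phi !fE eu.
have sfX m i : (s ^+ m)%g (f i) = f ((u ^+ m)%g i).
  by rewrite !permX; elim: m => //= m ->.
have porbitE i : f @: porbit u i = porbit s (f i).
  apply/setP => j; apply/imsetP/porbitP => [[_ /porbitP[m ->] ->]|[m ->]].
    by exists m; rewrite sfX.
  by exists ((u ^+ m)%g i); rewrite ?mem_porbit ?sfX.
rewrite /num_cycles /orbits_in -(card_imset _ (imset_inj fI)); apply: eq_card => c.
rewrite inE; apply/imsetP/and3P => [[_ /setIdP[/imsetP[i _ ->] /eqP <-] ->]|[]].
  split; first by rewrite porbitE imset_f.
    by apply/fintype.subsetP => _ /imsetP[l _ ->].
  by rewrite card_imset.
move=> /imsetP[j _ ->] /fintype.subsetP/(_ j (porbit_id _ _))/fonto[i <-] ck.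
exists (porbit u i); last by rewrite porbitE.
by rewrite inE imset_f //= -(card_imset _ fI) porbitE.
Qed.

Hypothesis (K : nat).
Hypothesis epsP : forall x, (exists2 m, (0 < m <= K)%N & iter m phi x = x) <-> range eps x.

(** An orbit contained in a set of n elements has length at most n. *)
Lemma conf_sub_image n (C : set T) : (n <= K)%N -> conf phi n C ->
  C = eps @` [set` pull C].
Proof.
move=> le_nK [/card_eq_enumP[e eI eC] phiC]; apply/seteqP.
split=> [x Cx|_ [i /= /mem_pull iC <-] //].
suff [i _ ei] : range eps x by exists i => //=; apply/mem_pull; rewrite ei.
apply/epsP.
have Citer m : C (iter m phi x) by elim: m => //= m IHm; rewrite -phiC; exists (iter m phi x).
have /choice[f fE] (m : 'I_n.+1) : exists i, e i = iter m phi x.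
  by have := Citer m; rewrite -eC => -[i _]; exists i.
have /injectivePn[a [b a_ne_b fab]] : ~~ injectiveb f.
  by apply/injectiveP => /leq_card; rewrite !card_ord ltnn.
have iter_phi_inj m y z : iter m phi y = iter m phi z -> y = z.
  by elim: m => //= m IHm /phi_inj.
wlog lt_ab : a b a_ne_b fab / (a < b)%N.
  move=> W; have := a_ne_b; rewrite neq_ltn => /orP[|]; first exact: W.
  by apply: W => //; rewrite eq_sym.
exists (b - a)%N.
  by rewrite subn_gt0 lt_ab (leq_trans (leq_subr _ _)) // (leq_trans _ le_nK) // -ltnS.
apply: (iter_phi_inj a); rewrite -iterD subnKC ?(ltnW lt_ab) //.
by rewrite -!fE fab.
Qed.

Lemma sum_conf (la : seq nat) n : (n <= K)%N ->
  \sum_(C \in conf phi n) ((binomX la (frob_perm phi n C))%:R : rat) =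
  \sum_(C : {set 'I_N} | perm_stable s C && (#|C| == n))
    (\prod_(1 <= k < (size la).+1) 'C(orbits_in s C k, nth 0%N la k.-1))%:R.
Proof.
move=> le_nK; rewrite [RHS]bigfs ?index_enum_uniq //; last first.
  by move=> C _; rewrite mem_index_enum.
rewrite (@reindex_fsbig _ _ _ _ _ (fun C : {set 'I_N} => eps @` [set` C])
  [set` [pred C : {set 'I_N} | perm_stable s C && (#|C| == n)]]).
  apply: eq_fsbigr => C /set_mem /= Cn.
  have /frob_perm_exists/num_cycles_orbits_in cE := (conf_image C n).2 Cn.
  by congr (_%:R); rewrite /binomX; apply: eq_bigr => k _; rewrite cE.
split=> [C /= Cn|C C' _ _ eCC'|C Cn]; first exact/conf_image.
  by rewrite -(pullK C) eCC' pullK.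
have eC := conf_sub_image le_nK Cn.
by exists (pull C) => //; apply/conf_image; rewrite -eC.
Qed.

End Enumeration.

Lemma enumeration (T : Type) (phi : T -> T) K : injective phi ->
  (forall m, (0 < m)%N -> finite_set [set x | iter m phi x = x]) ->
  exists N (eps : 'I_N -> T) (s : 'S_N),
    [/\ injective eps, forall i, phi (eps i) = eps (s i)
      & forall x, (exists2 m, (0 < m <= K)%N & iter m phi x = x) <-> range eps x].
Proof.
move=> phi_inj fin; pose TK := [set x | exists2 m, (0 < m <= K)%N & iter m phi x = x].
have /finite_setP[N /card_eq_enumP[eps eI eTK]] : finite_set TK.
  apply: (@sub_finite_set _ _
    (\bigcup_(m in [set m | (0 < m <= K)%N]) [set x | iter m phi x = x])).
    by move=> x [m mK phix]; exists m.
  apply: bigcup_finite => [|m /= /andP[m0 _]]; last exact: fin.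
  apply: sub_finite_set (finite_II K.+1) => m /= /andP[_]; exact.
have /choice[f fE] i : exists j, phi (eps i) = eps j.
  have : TK (phi (eps i)).
    have : TK (eps i) by rewrite -eTK; exists i.
    by move=> [m mK phim]; exists m; rewrite // -iterSr iterS phim.
  by rewrite -eTK => -[j _ <-]; exists j.
have fI : injective f by move=> i j fij; apply/eI/phi_inj; rewrite !fE fij.
by exists N, eps, (perm fI); split=> // [i|x]; rewrite ?permE ?fE // eTK.
Qed.
(** * The generating function *)

Lemma orbit_representatives (T : Type) (phi : T -> T) (phi_inj : injective phi)
    (N K : nat) (eps : 'I_N -> T) (s : 'S_N) (eps_inj : injective eps)
    (eps_phi : forall i, phi (eps i) = eps (s i))
    (epsP : forall x, (exists2 m, (0 < m <= K)%N & iter m phi x = x) <-> range eps x) d :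
  (0 < d <= K)%N -> exists x : 'I_(orbits_in s [set: 'I_N] d) -> T,
  [/\ forall i, period phi (x i) d,
      forall i j m, x j = iter m phi (x i) -> i = j
    & forall z, period phi z d -> exists i m, z = iter m phi (x i)].
Proof.
move=> dK; set O := [set c in porbits s | (c \subset [set: 'I_N]) && (#|c| == d)]%SET.
rewrite /orbits_in -/O.
have /choice[a aP] (i : 'I_#|O|) : exists a, porbit s a = enum_val i /\ #|porbit s a| = d.
  have := enum_valP i; rewrite inE => /and3P[/imsetP[a _ ->] _ /eqP ad].
  by exists a.
exists (eps \o a); split=> [i|i j m|z zd].
- by apply/(period_eps eps_inj eps_phi); have [] := aP i.
- rewrite /= (iter_eps eps_phi) => /eps_inj aj; apply: enum_val_inj.
  by rewrite -(aP i).1 -(aP j).1 aj -permX porbit_perm.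
have [b _ bz] : range eps z by apply/epsP; exists d => //; case: zd.
have bd : #|porbit s b| = d by apply/(period_eps eps_inj eps_phi); rewrite bz.
have bO : porbit s b \in O by rewrite inE imset_f // finset.subsetT bd eqxx.
pose i := enum_rank_in bO (porbit s b).
have : b \in porbit s (a i) by rewrite (aP i).1 enum_rankK_in // porbit_id.
move/porbitP => [m bE]; exists i, m.
by rewrite /= (iter_eps eps_phi) -permX -bE bz.
Qed.

Theorem theorem3
  (V : zfunctor) (V_variety : variety V) (V_smooth : smooth V)
  (V_connected : connected V) (V_dim : positive_dimension V)
  (p r q : nat) (p_prime : prime p) (r_gt0 : (0 < r)%N) (qE : q = (p ^ r)%N)
  (q_odd : odd q)
  (F : nat -> finFieldType) (F_card : forall m, (0 < m)%N -> #|F m| = (q ^ m)%N)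
  (Fbar : closedFieldType) (inc : {rmorphism F 1%N -> Fbar})
  (Fbar_algebraic : forall y : Fbar, algebraicOver inc y)
  (Frob : {rmorphism Fbar -> Fbar}) (FrobE : forall y, Frob y = y ^+ q)
  (lambda : seq nat) :
  Fps (fun n : nat =>
    \sum_(C \in conf (fmap V Frob) n)
      ((binomX lambda (frob_perm (fmap V Frob) n C))%:R : rat)) =
  zeta V (F 1%N) / fps_dilate 2 (zeta V (F 1%N)) *
  \prod_(1 <= k < (size lambda).+1)
    (fpsC (binom (necklace V F k) (nth 0%N lambda k.-1)) *
     ('t ^+ k / (1 + 't ^+ k)) ^+ nth 0%N lambda k.-1).
Proof.
have [_ V_sep V_ft] := V_variety.
have cardF1 : #|F 1%N| = q by rewrite F_card // expn1.
rewrite -cardF1 in qE F_card FrobE.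
have phi_inj := phi_inj V_sep (Frob := Frob).
have embed m : (0 < m)%N -> exists e : {rmorphism F m -> Fbar},
    forall x, iter m (fmap V Frob) x = x <-> exists y, fmap V e y = x.
  move=> m0; have [e _] := finite_subfield p_prime qE F_card inc FrobE m0.
  by exists e => x; apply: (phi_fixed V_ft FrobE); apply: F_card.
have fin m : (0 < m)%N -> finite_set [set x | iter m (fmap V Frob) x = x].
  move=> /embed[e eP].
  apply: sub_finite_set (finite_image (fmap V e) (finite_points (F m) V_ft)).
  by move=> x /eP[y <-]; exists y.
(* Points of period at most n suffice for the sets C of n elements, and those of
   period at most size lambda for the binomials in the M_k. *)
apply: fpsP => n; pose K := (n + size lambda)%N.
have [N [eps [s [eps_inj eps_phi epsP]]]] := enumeration K phi_inj fin.
pose M d := num_closed_points V (F 1%N) d.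
have orbM d : (0 < d <= K)%N -> orbits_in s [set: 'I_N] d = M d.
  move=> dK.
  have [x [xd xI xall]] := orbit_representatives phi_inj eps_inj eps_phi epsP dK.
  have d0 : (0 < d)%N by case/andP: dK.
  by rewrite -(num_closed_points_orbits V_sep V_ft p_prime qE F_card inc FrobE xd xI xall d0).
have cardV m : (0 < m <= K)%N -> natcard [set: V (F m)] = (\sum_(d <- divisors m) d * M d)%N.
  move=> /andP[m0 mK]; have [e eP] := embed m m0.
  pose C := [set i | iter m s i == i]%SET.
  transitivity #|C|.
    have /choice[y yP] (i : 'I_#|C|) : exists y, fmap V e y = eps (enum_val i).
      apply/eP; rewrite (iter_eps eps_phi).
      by have := enum_valP i; rewrite inE => /eqP ->.
    apply: (@natcardE _ _ _ y) => [i j yij|].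
      by apply/enum_val_inj/eps_inj; rewrite -!yP yij.
    apply/seteqP; split=> // z _.
    have phiz : iter m (fmap V Frob) (fmap V e z) = fmap V e z by apply/eP; exists z.
    have [i _ iz] : range eps (fmap V e z) by apply/epsP; exists m; rewrite ?m0.
    have iC : i \in C by rewrite inE; apply/eqP/eps_inj; rewrite -(iter_eps eps_phi) iz.
    exists (enum_rank_in iC i) => //.
    apply: (separated_fmap_inj V_sep (fmorph_inj e)).
    by rewrite yP enum_rankK_in.
  rewrite card_iter_fixed // !big_seq; apply: eq_bigr => d; rewrite -dvdn_divisors // => dm.
  by rewrite orbM // (dvdn_gt0 m0 dm) (leq_trans (dvdn_leq m0 dm)).
have neckM k : (0 < k <= K)%N -> necklace V F k = (M k)%:R.
  move=> /andP[k0 kK]; apply: necklaceE => // m mk; apply: cardV.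
  by rewrite (dvdn_gt0 k0 mk) (leq_trans (dvdn_leq k0 mk)).
pose la k := nth 0%N lambda k.-1.
have la0 k : (size lambda < k)%N -> la k = 0%N by case: k => // k lt_k; apply: nth_default.
have leK : (size lambda <= K)%N by apply: leq_addl.
have -> : \prod_(1 <= k < (size lambda).+1)
    (fpsC (binom (necklace V F k) (nth 0%N lambda k.-1)) *
     ('t ^+ k / (1 + 't ^+ k)) ^+ nth 0%N lambda k.-1) =
  \prod_(1 <= k < (size lambda).+1)
    (fpsC 'C(M k, la k)%:R * ('t ^+ k / (1 + 't ^+ k)) ^+ la k) :> fps rat.
  rewrite !big_nat; apply: eq_bigr => k /andP[k0 kl].
  by rewrite neckM ?binom_nat // k0 (leq_trans _ leK).
rewrite [RHS](@euler_binomial_eqmod rat M K la _ leK la0 n (leq_addr _ _)).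
have -> : \prod_(1 <= k < K.+1)
     \sum_(j < (M k).+1) ('C(M k, j) * 'C(j, la k))%:R * ('t ^+ k) ^+ j =
   \prod_(1 <= k < K.+1) \sum_(j < (orbits_in s [set: 'I_N] k).+1)
     ('C(orbits_in s [set: 'I_N] k, j) * 'C(j, la k))%:R * ('t ^+ k) ^+ j :> fps rat.
  by rewrite !big_nat; apply: eq_bigr => k kK; rewrite orbM.
rewrite -sum_stable_binomial; last first.
  move=> _ /imsetP[i _ ->].
  have [m /andP[m0 mK] phim] : exists2 m, (0 < m <= K)%N & iter m (fmap V Frob) (eps i) = eps i.
    by apply/epsP; exists i.
  apply: leq_trans mK; apply: dvdn_leq => //; rewrite -iter_fixed_porbit.
  by apply/eqP/eps_inj; rewrite -(iter_eps eps_phi).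
rewrite [LHS](sum_conf phi_inj eps_inj eps_phi epsP) ?leq_addr // fcoef_sum.
rewrite [RHS]big_mkcond [LHS]big_mkcond; apply: eq_bigr => C _.
case: (perm_stable s C); last by [].
rewrite andTb -fpsC_nat fcoefMC fcoefXn eq_sym.
case: eqP => _; rewrite ?mulr0 // mulr1; congr (_%:R).
rewrite [RHS](big_cat_nat (n := (size lambda).+1)) //=.
rewrite [X in (_ * X)%N]big_nat [X in (_ * X)%N]big1 ?muln1 // => k /andP[lk _].
by rewrite la0 // bin0.
Qed.
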